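(* Let $\alpha$ and $\beta$ be nonzero $L^\infty$ functions, and let $Z_\alpha$ and $Z_\beta$ denote the zero sets of $\alpha$ and $\beta$ respectively. (i) If $|Z_\alpha|=0$ or $|Z_\beta|=0$, then at least one of $S_{\alpha,\beta}$ and $S_{\alpha,\beta}^*$ is injective. (ii) Let $|Z_\alpha|\neq0$ and $|Z_\beta|\neq0$. If $Z_\alpha\neq Z_\beta$ in the sense of measure (i.e. the symmetric difference of $Z_\alpha$ and $Z_\beta$ has positive measure), then $S_{\alpha,\beta}$ is injective. (iii) Let $|Z_\alpha|\neq0$ and $|Z_\beta|\neq0$. Then $S_{\alpha,\beta}^*$ is injective if and only if $|Z_\alpha\cap Z_\beta|=0$.
   Context: $S^1=\{z\in\mathbb{C}:|z|=1\}$; for measurable $A\subset S^1$, $|A|$ is its Lebesgue measure. $L^2=L^2(S^1)$, $L^\infty=L^\infty(S^1)$ (complex-valued functions); a nonzero function is one that is not a.e. equal to $0$. $H^2$ is the Hardy space of all $f\in L^2$ whose negative Fourier coefficients vanish, and $H^{2\bot}$ is its orthogonal complement in $L^2$. $P$ and $Q=I-P$ are the orthogonal projections of $L^2$ onto $H^2$ and $H^{2\bot}$. For $\alpha,\beta\in L^\infty$, the operator $S_{\alpha,\beta}$ on $L^2$ is $S_{\alpha,\beta}f=\alpha Pf+\beta Qf$, with adjoint $S_{\alpha,\beta}^*$. *)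

(* Defs.v *)
From HB Require Import structures.
From mathcomp Require Import all_boot all_order all_algebra.
From mathcomp Require Import all_classical all_reals all_analysis measurable_realfun.
From mathcomp Require Import complex.

Set Implicit Arguments.
Unset Strict Implicit.
Unset Printing Implicit Defensive.

Import Order.TTheory GRing.Theory Num.Theory.
Import numFieldNormedType.Exports.

Local Open Scope classical_set_scope.
Local Open Scope complex_scope.
Local Open Scope ring_scope.

Definition circle (R : realType) : Type := {z : R[i] | `|z| == 1}.

Section circle_measure.
Context {R : realType}.

HB.instance Definition _ := Choice.on (circle R).

Lemma circle_one_subproof : `|1 : R[i]| == 1.
Proof. by rewrite normr1. Qed.

HB.instance Definition _ :=
  isPointed.Build (circle R) (exist _ (1 : R[i]) circle_one_subproof).

(* The sigma-algebra of the circle is the trace of the Borel sigma-algebra of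
   the plane R * R. *)
Definition circle_coord (z : circle R) : measurableTypeR R * measurableTypeR R :=
  (complex.Re (val z), complex.Im (val z)).

Definition circle_measurable : set (set (circle R)) :=
  preimage_set_system setT circle_coord measurable.

Let circle_sigma_algebra : sigma_algebra setT circle_measurable.
Proof. exact/sigma_algebra_preimage/sigma_algebra_measurable. Qed.

Let circle_measurable0 : circle_measurable set0.
Proof. by case: circle_sigma_algebra. Qed.

Let circle_measurableC A :
  circle_measurable A -> circle_measurable (~` A).
Proof.
by case: circle_sigma_algebra => _ + _ => /[apply]; rewrite setTD.
Qed.

Let circle_measurable_bigcup (F : (set (circle R))^nat) :
  (forall i, circle_measurable (F i)) -> circle_measurable (\bigcup_i F i).
Proof. by case: circle_sigma_algebra => _ _; exact. Qed.

HB.instance Definition _ := @isMeasurable.Build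
  (preimage_display circle_coord) (circle R) circle_measurable
  circle_measurable0 circle_measurableC circle_measurable_bigcup.

Lemma expi_subproof (t : R) : `|cos t +i* sin t| == 1.
Proof.
by rewrite normc_def /= cos2Dsin2 sqrtr1.
Qed.

Definition expi (t : measurableTypeR R) : circle R :=
  exist _ (cos t +i* sin t) (expi_subproof t).

Lemma measurable_expi : measurable_fun [set: measurableTypeR R] expi.
Proof.
move=> _ _ [B mB <-]; rewrite !setTI -[X in measurable X]setTI.
rewrite -comp_preimage.
have mf : measurable_fun [set: measurableTypeR R] (circle_coord \o expi).
  apply/measurable_fun_pairP; split => /=.
    by apply: continuous_measurable_fun; exact: continuous_cos.
  by apply: continuous_measurable_fun; exact: continuous_sin.
exact: mf.
Qed.

(* Lebesgue (arc length) measure: the image of Lebesgue measure on [0, 2 pi[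
   under t |-> e^{it}; its total mass is 2 pi. *)
Definition arclength : set (circle R) -> \bar R :=
  pushforward (mrestr lebesgue_measure (measurable_itv `[0, 2 * pi[%R)) expi.

Let arclength0 : arclength set0 = 0%E.
Proof. by rewrite /arclength /pushforward preimage_set0 measure0. Qed.

Let arclength_ge0 A : (0 <= arclength A)%E.
Proof. by rewrite /arclength /pushforward; exact: measure_ge0. Qed.

Let arclength_semi_sigma_additive : semi_sigma_additive arclength.
Proof.
move=> F mF tF mUF; rewrite /arclength /pushforward preimage_bigcup.
have mpre B : measurable B -> measurable (expi @^-1` B).
  by move=> mB; rewrite -[X in measurable X]setTI; exact: measurable_expi.
apply: measure_semi_sigma_additive.
- by move=> n; exact: mpre.
- apply/trivIsetP => i j _ _ ij; rewrite -preimage_setI.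
  by move/trivIsetP : tF => /(_ _ _ _ _ ij) ->//; rewrite preimage_set0.
- by rewrite -preimage_bigcup; exact: mpre.
Qed.

HB.instance Definition _ := isMeasure.Build _ _ _ arclength
  arclength0 arclength_ge0 arclength_semi_sigma_additive.

End circle_measure.

Section hardy_space.
Context {R : realType}.
Implicit Types (f g h : circle R -> R[i]) (M : set (circle R -> R[i])).

Definition cmeasurable f : Prop :=
  measurable_fun [set: circle R] (fun z => complex.Re (f z)) /\
  measurable_fun [set: circle R] (fun z => complex.Im (f z)).

(* L^p as a set of functions: two functions represent the same element of L^p
   when they agree almost everywhere. *)
Definition Lp_circle (p : \bar R) : set (circle R -> R[i]) :=
  [set f | cmeasurable f /\
    (Lnorm (@arclength R) p (fun z => (ComplexField.Normc.normc (f z))%:E) < +oo)%E].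

Notation L2 := (Lp_circle 2%:E).

Definition cintegral f : R[i] :=
  (\int[@arclength R]_z complex.Re (f z)) +i*
  (\int[@arclength R]_z complex.Im (f z)).

Definition inner f g : R[i] := cintegral (fun z => f z * (g z)^*%C).

Definition fourier_coef f (n : int) : R[i] :=
  ((2 * pi)^-1)%:C * cintegral (fun z => f z * val z ^ (- n)).

Definition hardy : set (circle R -> R[i]) :=
  [set f | L2 f /\ forall n : int, n < 0 -> fourier_coef f n = 0].

Definition orth_compl M : set (circle R -> R[i]) :=
  [set g | L2 g /\ forall f, M f -> inner g f = 0].

(* The orthogonal projection of f onto a closed subspace M of L^2: the element
   g of M (unique up to a null set) such that f - g is orthogonal to M. *)
Definition orth_proj M f : circle R -> R[i] :=
  xget (fun=> 0) [set g | M g /\ orth_compl M (fun z => f z - g z)].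

Definition P_plus f := orth_proj hardy f.

Definition Q_minus f := fun z => f z - P_plus f z.

Definition S_op (alpha beta : circle R -> R[i]) f : circle R -> R[i] :=
  fun z => alpha z * P_plus f z + beta z * Q_minus f z.

(* The adjoint of a bounded operator T on L^2: its value at g is the h in L^2
   (unique up to a null set) such that <T f, g> = <f, h> for every f in L^2. *)
Definition adjoint (T : (circle R -> R[i]) -> circle R -> R[i]) g :
    circle R -> R[i] :=
  xget (fun=> 0)
    [set h | L2 h /\ forall f, L2 f -> inner (T f) g = inner f h].

Definition L2_injective (T : (circle R -> R[i]) -> circle R -> R[i]) : Prop :=
  forall f g, L2 f -> L2 g ->
    T f = T g %[ae @arclength R] -> f = g %[ae @arclength R].

Definition zero_set f : set (circle R) := [set z | f z = 0].

End hardy_space.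

Notation Linfty_circle R := (@Lp_circle R +oo%E).

(* Main.v *)
From HB Require Import structures.
Require Import Defs.
From mathcomp Require Import all_boot all_order all_algebra.
From mathcomp Require Import all_classical all_reals all_analysis.
From mathcomp Require Import complex measurable_realfun ess_sup_inf ring lra.

Set Implicit Arguments.
Unset Strict Implicit.
Unset Printing Implicit Defensive.

Import Order.TTheory GRing.Theory Num.Theory.
Import numFieldNormedType.Exports.

Local Open Scope classical_set_scope.
Local Open Scope complex_scope.
Local Open Scope ring_scope.

(* The heart of the matter is boundary uniqueness: a function [f] of [H^2] (or
   of its orthogonal complement) that vanishes on a set [E] of positive measure is
   [0] almost everywhere.  Let [g] be the component of [f] orthogonal to the
   functions of [z H^2] vanishing on [E]; since [z^k g] is such a function for
   all [k > 0], [|g|^2] is constant, hence [0] because of [E], so that [f] has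
   mean [0]; then iterate with [f / z].

   Write [u = P f] and [w = Q f].  If [alpha u + beta w = 0] then [w] vanishes
   where [alpha] does and [beta] does not, and [u] in the opposite situation,
   which gives (ii).  Next, [S^* g = 0] means that [conj(alpha) g] is orthogonal
   to [H^2] and [conj(beta) g] is in [H^2]; both are [0] when [alpha] and [beta]
   vanish on sets of positive measure, which gives (iii).  For (i), if both
   operators have a kernel, [alpha conj(g) u = - beta conj(g) w] has only
   positive frequencies on the left and negative ones on the right, so both sides
   are [0], and where [alpha <> 0] almost everywhere boundary uniqueness forces
   [u = 0] or [g = 0]. *)

Notation L2 := (Lp_circle 2%:E).
Notation Re := complex.Re.
Notation Im := complex.Im.

(** * Complex-valued functions on the circle *)

Section complex_parts.
Context {R : realType}.
Implicit Types x y : R[i].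

Lemma ReD x y : Re (x + y) = Re x + Re y. Proof. by case: x; case: y. Qed.
Lemma ImD x y : Im (x + y) = Im x + Im y. Proof. by case: x; case: y. Qed.
Lemma ReN x : Re (- x) = - Re x. Proof. by case: x. Qed.
Lemma ImN x : Im (- x) = - Im x. Proof. by case: x. Qed.
Lemma ReM x y : Re (x * y) = Re x * Re y - Im x * Im y.
Proof. by case: x; case: y. Qed.
Lemma ImM x y : Im (x * y) = Re x * Im y + Im x * Re y.
Proof. by case: x; case: y. Qed.
Lemma Re_conj x : Re x^*%C = Re x. Proof. by case: x. Qed.
Lemma Im_conj x : Im x^*%C = - Im x. Proof. by case: x. Qed.

Lemma complex_ext x y : Re x = Re y -> Im x = Im y -> x = y.
Proof. by case: x => a b; case: y => c d /= -> ->. Qed.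

Definition reimE := (ReD, ImD, ReN, ImN, ReM, ImM, Re_conj, Im_conj).

(** The squared modulus as a real polynomial in the two parts, so that identities and bounds reduce
    to real arithmetic without square roots. *)
Definition normsq x : R := Re x ^+ 2 + Im x ^+ 2.

Lemma normsq_ge0 x : 0 <= normsq x.
Proof. by rewrite addr_ge0 ?sqr_ge0. Qed.

Lemma normsq_eq0 x : (normsq x == 0) = (x == 0).
Proof.
by case: x => a b; rewrite /normsq paddr_eq0 ?sqr_ge0// !sqrf_eq0 eq_complex.
Qed.

Lemma normsqM x y : normsq (x * y) = normsq x * normsq y.
Proof. by rewrite /normsq !reimE; ring. Qed.

Lemma normsq_conj x : normsq x^*%C = normsq x.
Proof. by rewrite /normsq !reimE; ring. Qed.

Lemma normsqN x : normsq (- x) = normsq x.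
Proof. by rewrite /normsq !reimE; ring. Qed.

Lemma mul_conj x : x * x^*%C = (normsq x)%:C.
Proof. by apply: complex_ext; rewrite !reimE /normsq/=; ring. Qed.

Lemma sqr_normc x : ComplexField.Normc.normc x ^+ 2 = normsq x.
Proof. by case: x => a b /=; rewrite sqr_sqrtr// addr_ge0 ?sqr_ge0. Qed.

Lemma normsqD_le x y : normsq (x + y) <= 2 * normsq x + 2 * normsq y.
Proof.
rewrite /normsq !reimE.
have := sqr_ge0 (Re x - Re y); have := sqr_ge0 (Im x - Im y); nra.
Qed.

(** Arithmetic-geometric mean with a crude constant: the domination that makes a product of two
    [L^2] functions integrable. *)
Lemma normRe_mul_le x y : `|Re (x * y)| <= normsq x + normsq y.
Proof.
rewrite /normsq !reimE ler_norml; apply/andP; split.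
  have := sqr_ge0 (Re x + Re y); have := sqr_ge0 (Im x - Im y).
  have := sqr_ge0 (Re x); have := sqr_ge0 (Im x); have := sqr_ge0 (Re y).
  have := sqr_ge0 (Im y); nra.
have := sqr_ge0 (Re x - Re y); have := sqr_ge0 (Im x + Im y).
have := sqr_ge0 (Re x); have := sqr_ge0 (Im x); have := sqr_ge0 (Re y).
have := sqr_ge0 (Im y); nra.
Qed.

Lemma normIm_mul_le x y : `|Im (x * y)| <= normsq x + normsq y.
Proof.
(* Multiplication by [- 'i] turns the imaginary part into the real part and keeps the modulus. *)
have -> : Im (x * y) = Re (x * (y * - 'i)).
  by rewrite !reimE /=; ring.
rewrite (le_trans (normRe_mul_le _ _))// lerD2l.
by rewrite /normsq !reimE /=; lra.
Qed.

End complex_parts.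

(** * Total mass of the circle and measurability of complex functions *)

Section circle_functions.
Context {R : realType}.
Notation mu := (@arclength R).
Implicit Types (f g h : circle R -> R[i]) (A B : set (circle R)).

Lemma arclengthT : mu [set: circle R] = (2 * pi)%:E.
Proof.
rewrite /arclength/= /pushforward preimage_setT /mrestr setTI.
rewrite lebesgue_measure_itv/= lte_fin mulr_gt0 ?pi_gt0//.
by rewrite sube0.
Qed.

Lemma arclength_fin : fin_num_fun mu.
Proof.
by apply: lty_fin_num_fun; move: (ltry (2 * pi : R)); rewrite -arclengthT.
Qed.

HB.instance Definition _ :=
  Measure_isFinite.Build _ _ _ (@arclength R) arclength_fin.

Lemma measurable_circle_coord : measurable_fun setT (@circle_coord R).
Proof. by move=> _ Y mY; exists Y. Qed.

Lemma cmeasurable_val : cmeasurable (fun z : circle R => val z).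
Proof.
split.
  apply: (measurableT_comp (measurable_fst) measurable_circle_coord).
apply: (measurableT_comp (measurable_snd) measurable_circle_coord).
Qed.

Lemma cmeasurable_cst (c : R[i]) : cmeasurable (fun _ : circle R => c).
Proof. by split; exact: measurable_cst. Qed.

Lemma cmeasurableD f g : cmeasurable f -> cmeasurable g ->
  cmeasurable (fun z => f z + g z).
Proof.
move=> [f1 f2] [g1 g2]; split.
  by under eq_fun do rewrite ReD; exact: measurable_funD.
by under eq_fun do rewrite ImD; exact: measurable_funD.
Qed.

Lemma cmeasurableM f g : cmeasurable f -> cmeasurable g ->
  cmeasurable (fun z => f z * g z).
Proof.
move=> [f1 f2] [g1 g2]; split.
  under eq_fun do rewrite ReM.
  by apply: measurable_funB; exact: measurable_funM.
under eq_fun do rewrite ImM.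
by apply: measurable_funD; exact: measurable_funM.
Qed.

Lemma cmeasurable_conj f : cmeasurable f -> cmeasurable (fun z => (f z)^*%C).
Proof.
move=> [f1 f2]; split; first by under eq_fun do rewrite Re_conj.
by under eq_fun do rewrite Im_conj; exact: measurable_funN.
Qed.

Lemma cmeasurable_real (q : circle R -> R) :
  measurable_fun setT q -> cmeasurable (fun z => (q z)%:C).
Proof. by move=> mq; split => //=; exact: measurable_cst. Qed.

Lemma measurable_normsq f : cmeasurable f ->
  measurable_fun setT (fun z => normsq (f z)).
Proof.
by move=> [f1 f2]; apply: measurable_funD; exact: measurable_funX.
Qed.

End circle_functions.

(** * Integrals, the spaces [L^2] and [L^infty], and the inner product *)

Section circle_integral.
Context {R : realType}.
Notation mu := (@arclength R).
Notation integrableR q := (mu.-integrable setT (EFin \o q)).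
Implicit Types (f g h : circle R -> R[i]) (p q : circle R -> R).

Lemma integrableR_measurable q : integrableR q -> measurable_fun setT q.
Proof. by move=> /integrableP[/measurable_EFinP]. Qed.

Lemma integrableRD p q : integrableR p -> integrableR q ->
  integrableR (fun z => p z + q z).
Proof. by move=> ip iq; exact: (integrableD measurableT ip iq). Qed.

Lemma integrableRZ (c : R) q : integrableR q -> integrableR (fun z => c * q z).
Proof. by move=> iq; exact: (integrableZl measurableT c iq). Qed.

Lemma integrableRN q : integrableR q -> integrableR (fun z => - q z).
Proof. by move=> iq; exact: (integrableN iq). Qed.

Lemma le_integrable_ae p q : measurable_fun setT p ->
  (\forall z \ae mu, `|p z| <= q z) -> integrableR q -> integrableR p.
Proof.
move=> mp pq /integrableP[/measurable_EFinP mq qoo].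
apply/integrableP; split; first exact/measurable_EFinP.
apply: le_lt_trans qoo; apply: ae_ge0_le_integral => //.
- by apply/measurable_EFinP; exact: measurableT_comp.
- by apply/measurable_EFinP; exact: measurableT_comp.
- apply: filterS pq => z pqz _ /=.
  by rewrite lee_fin (le_trans pqz)// ler_norm.
Qed.

Lemma RintegralN q : integrableR q -> \int[mu]_z (- q z) = - \int[mu]_z q z.
Proof.
move=> iq; rewrite -mulN1r -RintegralZl//.
by apply: eq_Rintegral => z _; rewrite mulN1r.
Qed.

Definition cintegrable f :=
  integrableR (fun z => Re (f z)) /\ integrableR (fun z => Im (f z)).

Lemma cintegrable_measurable f : cintegrable f -> cmeasurable f.
Proof. by move=> [f1 f2]; split; exact: integrableR_measurable. Qed.

Lemma cintegrableD f g : cintegrable f -> cintegrable g ->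
  cintegrable (fun z => f z + g z).
Proof.
move=> [f1 f2] [g1 g2]; split.
  by under eq_fun do rewrite ReD; exact: integrableRD.
by under eq_fun do rewrite ImD; exact: integrableRD.
Qed.

Lemma cintegrableZ (c : R[i]) f : cintegrable f ->
  cintegrable (fun z => c * f z).
Proof.
move=> [f1 f2]; split.
  under eq_fun do rewrite ReM.
  by apply: integrableRD; [exact: integrableRZ|apply/integrableRN/integrableRZ].
under eq_fun do rewrite ImM.
by apply: integrableRD; exact: integrableRZ.
Qed.

Lemma cintegrable_real q : integrableR q -> cintegrable (fun z => (q z)%:C).
Proof. by move=> iq; split => //=; exact: finite_measure_integrable_cst. Qed.

Lemma cintegralD f g : cintegrable f -> cintegrable g ->
  cintegral (fun z => f z + g z) = cintegral f + cintegral g.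
Proof.
move=> [f1 f2] [g1 g2]; apply: complex_ext => /=.
  by rewrite -RintegralD//; apply: eq_Rintegral => z _; rewrite ReD.
by rewrite -RintegralD//; apply: eq_Rintegral => z _; rewrite ImD.
Qed.

Lemma cintegralZ (c : R[i]) f : cintegrable f ->
  cintegral (fun z => c * f z) = c * cintegral f.
Proof.
move=> [f1 f2]; apply: complex_ext.
  rewrite ReM /= -!RintegralZl// -RintegralB//; try exact: integrableRZ.
  by apply: eq_Rintegral => z _; rewrite ReM.
rewrite ImM /= -!RintegralZl// -RintegralD//; try exact: integrableRZ.
by apply: eq_Rintegral => z _; rewrite ImM.
Qed.

Lemma cintegral_conj f : cintegrable f ->
  cintegral (fun z => (f z)^*%C) = (cintegral f)^*%C.
Proof.
move=> [f1 f2]; apply: complex_ext; rewrite ?Re_conj ?Im_conj /=.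
  by apply: eq_Rintegral => z _; rewrite Re_conj.
by rewrite -RintegralN//; apply: eq_Rintegral => z _; rewrite Im_conj.
Qed.

Lemma cintegral_real q : cintegral (fun z => (q z)%:C) = (\int[mu]_z q z)%:C.
Proof.
by apply: complex_ext => //=; rewrite Rintegral_cst// mul0r.
Qed.

Lemma eq_cintegral f g : f =1 g -> cintegral f = cintegral g.
Proof. by move=> /funext ->. Qed.

Lemma ae_eq_cintegral f g : cmeasurable f -> cmeasurable g ->
  f = g %[ae mu] -> cintegral f = cintegral g.
Proof.
move=> [f1 f2] [g1 g2] fg; apply: complex_ext; congr fine.
  apply: ae_eq_integral => //; try exact/measurable_EFinP.
  by apply: filterS fg => z /[apply] ->.
apply: ae_eq_integral => //; try exact/measurable_EFinP.
by apply: filterS fg => z /[apply] ->.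
Qed.

Lemma cintegral0 : cintegral (fun _ : circle R => 0) = 0.
Proof. by rewrite (cintegral_real (fun=> 0)) Rintegral_cst// mul0r. Qed.

Lemma ae_eq0_normsq f : cmeasurable f -> \int[mu]_z normsq (f z) = 0 ->
  integrableR (fun z => normsq (f z)) -> f = (fun=> 0) %[ae mu].
Proof.
move=> mf f0 fi.
have mN := integrableR_measurable fi.
have : (\int[mu]_z (normsq (f z))%:E = 0)%E.
  by rewrite -[RHS]/(0%:E) -f0 fineK//; exact: integrable_fin_num.
under eq_integral do rewrite -[(normsq _)%:E]gee0_abs ?lee_fin ?normsq_ge0//.
have /measurable_EFinP mE := mN.
move=> /(ae_eq_integral_abs mu measurableT mE).1; apply: filterS => z /(_ I).
by move=> [] /eqP; rewrite normsq_eq0 => /eqP.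
Qed.

(** [Lnorm] is a root of the integral of the squared modulus, so one is finite exactly when the
    other is. *)
Lemma L2P f : L2 f <-> cmeasurable f /\ integrableR (fun z => normsq (f z)).
Proof.
rewrite /Lp_circle/=.
have e : (\int[mu]_z (`|(ComplexField.Normc.normc (f z))%:E| `^ 2) =
    \int[mu]_z `|(normsq (f z))%:E|)%E.
  apply: eq_integral => z _ /=.
  by rewrite powR_mulrn// real_normK ?num_real// sqr_normc ger0_norm ?normsq_ge0.
split=> -[mf h]; split=> //.
  apply/integrableP; split; first exact/measurable_EFinP/measurable_normsq.
  by move: h; rewrite unlock e => /lty_poweRy; apply; rewrite invr_eq0.
move: h => /integrableP[_ h].
by rewrite unlock e; exact: poweR_lty.
Qed.

Lemma L2_measurable f : L2 f -> cmeasurable f.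
Proof. by case. Qed.

Lemma L2_normsq f : L2 f -> integrableR (fun z => normsq (f z)).
Proof. by move=> /L2P[]. Qed.

Lemma arclengthT_gt0 : (0 < mu setT)%E.
Proof. by rewrite [X in (_ < X)%E]arclengthT lte_fin mulr_gt0// pi_gt0. Qed.

Lemma LinftyP f : Linfty_circle R f ->
  cmeasurable f /\ exists2 C, 0 <= C & \forall z \ae mu, normsq (f z) <= C.
Proof.
case=> mf; rewrite unlock arclengthT_gt0.
set M := ess_sup _ _ => Moo; split=> //.
exists ((fine M) ^+ 2); first exact: sqr_ge0.
have := ess_sup_ge mu (abse \o (fun z => (ComplexField.Normc.normc (f z))%:E)).
rewrite -/M; apply: filterS => z /= zM.
(* [M] dominates a modulus at [z], hence is nonnegative; with [Moo] it is finite, and [fine M] is a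
   true bound rather than a default value. *)
have Mfin : M \is a fin_num by rewrite ge0_fin_numE// (le_trans _ zM)// lee_fin.
have M0 : 0 <= fine M by rewrite -lee_fin fineK// (le_trans _ zM)// lee_fin.
rewrite -sqr_normc -[leLHS]real_normK ?num_real// ler_pXn2r// ?nnegrE//.
by rewrite -lee_fin fineK.
Qed.

Lemma L2D f g : L2 f -> L2 g -> L2 (fun z => f z + g z).
Proof.
move=> /L2P[mf nf] /L2P[mg ng].
have m := cmeasurableD mf mg; apply/L2P; split => //.
apply: (@le_integrable_ae _ (fun z => 2 * normsq (f z) + 2 * normsq (g z))).
- exact: measurable_normsq.
- by apply: aeW => z; rewrite ger0_norm ?normsq_ge0// normsqD_le.
- by apply: integrableRD; exact: integrableRZ.
Qed.

Lemma L2_bounded_mul (C : R) f g : cmeasurable f ->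
  (\forall z \ae mu, normsq (f z) <= C) -> L2 g -> L2 (fun z => f z * g z).
Proof.
move=> mf fC /L2P[mg ng].
have m := cmeasurableM mf mg; apply/L2P; split => //.
apply: (@le_integrable_ae _ (fun z => C * normsq (g z))).
- exact: measurable_normsq.
- apply: filterS fC => z fC.
  by rewrite ger0_norm ?normsq_ge0// normsqM ler_wpM2r ?normsq_ge0.
- exact: integrableRZ.
Qed.

Lemma L2_Linfty_mul f g : Linfty_circle R f -> L2 g -> L2 (fun z => f z * g z).
Proof. by move=> /LinftyP[mf [C _ fC]]; exact: (@L2_bounded_mul C). Qed.

Lemma L2Z (c : R[i]) f : L2 f -> L2 (fun z => c * f z).
Proof.
apply: (@L2_bounded_mul (normsq c)); first exact: cmeasurable_cst.
exact: aeW.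
Qed.

Lemma L2N f : L2 f -> L2 (fun z => - f z).
Proof. by move=> /(L2Z (-1)); under eq_fun do rewrite mulN1r. Qed.

Lemma L2B f g : L2 f -> L2 g -> L2 (fun z => f z - g z).
Proof. by move=> Lf Lg; apply: L2D => //; exact: L2N. Qed.

Lemma L2_conj f : L2 f -> L2 (fun z => (f z)^*%C).
Proof.
move=> /L2P[mf nf]; apply/L2P; split; first exact: cmeasurable_conj.
by under eq_fun do rewrite normsq_conj.
Qed.

Lemma L2_cst (c : R[i]) : L2 (fun _ : circle R => c).
Proof.
apply/L2P; split; first exact: cmeasurable_cst.
exact: finite_measure_integrable_cst.
Qed.

Lemma cintegrableM f g : L2 f -> L2 g -> cintegrable (fun z => f z * g z).
Proof.
move=> /L2P[mf nf] /L2P[mg ng]; have [m1 m2] := cmeasurableM mf mg.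
split.
  apply: (le_integrable_ae m1 _ (integrableRD nf ng)).
  by apply: aeW => z; exact: normRe_mul_le.
apply: (le_integrable_ae m2 _ (integrableRD nf ng)).
by apply: aeW => z; exact: normIm_mul_le.
Qed.

Lemma cintegrable_inner f g : L2 f -> L2 g ->
  cintegrable (fun z => f z * (g z)^*%C).
Proof. by move=> Lf Lg; apply: cintegrableM => //; exact: L2_conj. Qed.

Lemma L2_cintegrable f : L2 f -> cintegrable f.
Proof.
move=> Lf; have := cintegrableM Lf (L2_cst 1).
by under eq_fun do rewrite mulr1.
Qed.

Lemma innerDl f g h : L2 f -> L2 g -> L2 h ->
  inner (fun z => f z + g z) h = inner f h + inner g h.
Proof.
move=> Lf Lg Lh; rewrite /inner -cintegralD; try exact: cintegrable_inner.
by apply: eq_cintegral => z; rewrite mulrDl.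
Qed.

Lemma innerZl (c : R[i]) f h : L2 f -> L2 h ->
  inner (fun z => c * f z) h = c * inner f h.
Proof.
move=> Lf Lh; rewrite /inner -cintegralZ; last exact: cintegrable_inner.
by apply: eq_cintegral => z; rewrite mulrA.
Qed.

Lemma inner_sym f g : L2 f -> L2 g -> inner g f = (inner f g)^*%C.
Proof.
move=> Lf Lg; rewrite /inner -cintegral_conj; last exact: cintegrable_inner.
by apply: eq_cintegral => z; rewrite rmorphM/= conjcK mulrC.
Qed.

Lemma innerDr f g h : L2 f -> L2 g -> L2 h ->
  inner h (fun z => f z + g z) = inner h f + inner h g.
Proof.
move=> Lf Lg Lh; rewrite [LHS]inner_sym//; last exact: L2D.
by rewrite innerDl// rmorphD/= (inner_sym Lf Lh) (inner_sym Lg Lh).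
Qed.

Lemma innerZr (c : R[i]) f h : L2 f -> L2 h ->
  inner h (fun z => c * f z) = c^*%C * inner h f.
Proof.
move=> Lf Lh; rewrite [LHS]inner_sym//; last exact: L2Z.
by rewrite innerZl// rmorphM/= (inner_sym Lf Lh).
Qed.

Lemma innerBl f g h : L2 f -> L2 g -> L2 h ->
  inner (fun z => f z - g z) h = inner f h - inner g h.
Proof.
move=> Lf Lg Lh; rewrite -mulN1r -innerZl// -innerDl//; last exact: L2Z.
by congr inner; apply/funext => z; rewrite mulN1r.
Qed.

Lemma innerBr f g h : L2 f -> L2 g -> L2 h ->
  inner h (fun z => f z - g z) = inner h f - inner h g.
Proof.
move=> Lf Lg Lh; rewrite [LHS]inner_sym//; last exact: L2B.
by rewrite innerBl// rmorphB/= (inner_sym Lf Lh) (inner_sym Lg Lh).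
Qed.

Lemma inner0l h : inner (fun=> 0) h = 0.
Proof. by rewrite -[RHS]cintegral0; apply: eq_cintegral => z; rewrite mul0r. Qed.

Lemma ae_eq_inner f g h : L2 f -> L2 g -> L2 h -> f = g %[ae mu] ->
  inner f h = inner g h.
Proof.
move=> Lf Lg Lh fg; apply: ae_eq_cintegral.
- exact/cintegrable_measurable/cintegrable_inner.
- exact/cintegrable_measurable/cintegrable_inner.
- by apply: filterS fg => z /[apply] ->.
Qed.

Definition sqnorm f : R := \int[mu]_z normsq (f z).

Lemma sqnorm_ge0 f : 0 <= sqnorm f.
Proof. by apply: Rintegral_ge0 => z _; exact: normsq_ge0. Qed.

Lemma inner_sqnorm f : inner f f = (sqnorm f)%:C.
Proof. by rewrite -cintegral_real; apply: eq_cintegral => z; exact: mul_conj. Qed.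

Lemma sqnorm_eq0 f : L2 f -> sqnorm f = 0 -> f = (fun=> 0) %[ae mu].
Proof. by move=> /L2P[mf nf] f0; exact: ae_eq0_normsq. Qed.

Lemma sqnormN f : sqnorm (fun z => - f z) = sqnorm f.
Proof. by apply: eq_Rintegral => z _; rewrite normsqN. Qed.

Lemma sqnormD f g : L2 f -> L2 g ->
  sqnorm (fun z => f z + g z) = sqnorm f + sqnorm g + 2 * Re (inner f g).
Proof.
move=> Lf Lg; have Lfg := L2D Lf Lg.
have : inner (fun z => f z + g z) (fun z => f z + g z) =
  inner f f + inner g g + (inner f g + (inner f g)^*%C).
  by rewrite innerDl// !innerDr// (inner_sym Lf Lg); ring.
rewrite !inner_sqnorm => /(congr1 (@complex.Re R)).
by rewrite !ReD Re_conj /= => ->; ring.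
Qed.

Lemma sqnormZ (c : R[i]) f : L2 f ->
  sqnorm (fun z => c * f z) = normsq c * sqnorm f.
Proof.
move=> Lf; rewrite /sqnorm -RintegralZl//; last exact: L2_normsq.
by apply: eq_Rintegral => z _; rewrite normsqM.
Qed.

Lemma cauchy_schwarz f g : L2 f -> L2 g ->
  normsq (inner f g) <= sqnorm f * sqnorm g.
Proof.
move=> Lf Lg; set c := inner f g.
(* The expansion of the squared norm of [f - t c g], with [c = <f, g>]. *)
have key (t : R) :
    0 <= sqnorm f + t ^+ 2 * normsq c * sqnorm g - 2 * t * normsq c.
  have := sqnorm_ge0 (fun z => f z + (- t%:C * c) * g z).
  rewrite sqnormD//; last exact: L2Z.
  rewrite sqnormZ// innerZr// -/c normsqM.
  rewrite (_ : normsq (- t%:C) = t ^+ 2); last by rewrite /normsq /=; ring.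
  rewrite (_ : Re _ = - t * normsq c); first by move=> h; lra.
  by rewrite /normsq !reimE /=; ring.
have [g0|g0] := eqVneq (sqnorm g) 0.
  rewrite g0 mulr0 leNgt; apply/negP => c0.
  (* When [g] has norm [0] the expansion is affine in [t]; this [t] gives it the value [-1]. *)
  have := key ((sqnorm f + 1) / (2 * normsq c)).
  rewrite g0 mulr0 addr0 (_ : 2 * _ * _ = sqnorm f + 1); first by lra.
  by field; rewrite gt_eqF.
have {}g0 : 0 < sqnorm g by rewrite lt_neqAle eq_sym g0 sqnorm_ge0.
(* The minimizing value of [t]. *)
have := key ((sqnorm g)^-1).
rewrite (_ : _ + _ - _ = sqnorm f - normsq c / sqnorm g).
  by rewrite subr_ge0 ler_pdivrMr.
by field; rewrite gt_eqF.
Qed.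

End circle_integral.

(** * Completeness of L^2 and orthogonal projections *)

Section L2_complete.
Context {R : realType}.
Notation mu := (@arclength R).
Notation integrableR q := (mu.-integrable setT (EFin \o q)).
Implicit Types (f g h : circle R -> R[i]).

Lemma geometric_step_cvg (u : R^nat) (K : R) :
  (forall n, `|u n.+1 - u n| <= K * 2^-1 ^+ n) -> cvgn u.
Proof.
move=> uK.
have -> : u = (fun n => u 0%N + series (telescope u) n).
  by apply/funext => n; rewrite telescopeK addrC subrK.
apply: is_cvgD; first exact: is_cvg_cst.
apply: normed_cvg; apply: (@series_le_cvg _ _ (fun n => K * 2^-1 ^+ n)) => //.
- by move=> n /=.
- by move=> n; rewrite (le_trans _ (uK n)).
- apply: is_cvg_geometric_series.
  by rewrite ger0_norm ?invr_ge0// invf_lt1// ltr1n.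
Qed.

Lemma measurable_fine_limsup (u : nat -> circle R -> R) :
  (forall n, measurable_fun setT (u n)) ->
  measurable_fun setT (fun z => fine (limn_esup (fun n => (u n z)%:E))).
Proof.
move=> mu_; apply: (measurableT_comp (fine_measurable measurableT)).
by apply: measurable_fun_limn_esup => n; exact/measurable_EFinP.
Qed.

Lemma fine_limsup_cvg (u : R^nat) :
  cvgn u -> u n @[n --> \oo] --> fine (limn_esup (fun n => (u n)%:E)).
Proof.
move=> /cvg_ex[l ul].
have : (u n)%:E @[n --> \oo] --> l%:E by apply: cvg_EFin => //; exact: nearW.
by move=> /cvg_limn_einf_sup[_ ->].
Qed.

(** The rate [8^-n] splits as [4^-n * 2^-n]. The series of [4^n |v_n - v_(n+1)|^2] has integral at
    most the sum of the [2^-n], so it is finite almost everywhere, and there the steps decay like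
    [2^-n]. *)
Lemma L2_fast_cauchy_ae_cvg (v : nat -> circle R -> R[i]) :
  (forall n, L2 (v n)) ->
  (forall n, sqnorm (fun z => v n z - v n.+1 z) <= 8^-1 ^+ n) ->
  \forall z \ae mu, cvgn (fun n => Re (v n z)) /\ cvgn (fun n => Im (v n z)).
Proof.
move=> Lv v8.
pose w n z : \bar R := (4 ^+ n * normsq (v n z - v n.+1 z))%:E.
have w0 n z : setT z -> (0 <= w n z)%E.
  by move=> _; rewrite lee_fin mulr_ge0 ?normsq_ge0// exprn_ge0.
have iw n : mu.-integrable setT (w n).
  by apply: integrableRZ; apply: L2_normsq; exact: L2B.
have mw n : measurable_fun setT (w n) by apply: measurable_int (iw n).
have wle n : (\int[mu]_z w n z <= (2^-1 ^+ n)%:E)%E.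
  rewrite -(@fineK _ (\int[mu]_z w n z)%E); last exact: integrable_fin_num.
  rewrite lee_fin -/(Rintegral _ _ _) RintegralZl//; last first.
    by apply: L2_normsq; exact: L2B.
  rewrite (le_trans (ler_wpM2l _ (v8 n))) ?exprn_ge0//.
  by rewrite -exprMn (_ : 4 * 8^-1 = 2^-1 :> R)//; field.
have iS : mu.-integrable setT (fun z => \sum_(n <oo) w n z)%E.
  apply/integrableP; split.
    by apply: (ge0_emeasurable_sum (P := xpredT)) => // n z ? _; exact: w0.
  rewrite (eq_integral (fun z => \sum_(n <oo) w n z)%E); last first.
    by move=> z _; rewrite gee0_abs// nneseries_ge0// => n _ _; exact: w0.
  rewrite integral_nneseries//.
  apply: (@le_lt_trans _ _ (\sum_(n <oo) (2^-1 ^+ n)%:E)%E).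
    apply: lee_nneseries => [n _ _|n _]; last exact: wle.
    by apply: integral_ge0 => z; exact: w0.
  have /cvg_ex[l hl] : cvgn (series (geometric (1 : R) 2^-1)).
    apply: is_cvg_geometric_series.
    by rewrite ger0_norm ?invr_ge0// invf_lt1// ltr1n.
  rewrite (_ : (\sum_(n <oo) _)%E = l%:E) ?ltry//.
  apply/cvg_lim => //.
  rewrite (_ : (fun n => _) = EFin \o series (geometric (1 : R) 2^-1)).
    by apply: cvg_EFin => //; exact: nearW.
  apply/funext => n /=; rewrite /series/= -sumEFin.
  by apply: eq_bigr => i _; rewrite mul1r.
have := integrable_ae measurableT iS; apply: filterS => z /(_ I) fS.
(* Each term is at most the whole sum [K^2], so the [n]-th step is at most [K / 2^n]. *)
pose K := Num.sqrt (fine (\sum_(n <oo) w n z)%E).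
have wK n : normsq (v n z - v n.+1 z) <= (K * 2^-1 ^+ n) ^+ 2.
  have : (w n z <= \sum_(n <oo) w n z)%E.
    rewrite (@nneseriesD1 _ (w ^~ z) n xpredT)//; last by move=> k _; exact: w0.
    by rewrite leeDl// nneseries_ge0// => k _ _; exact: w0.
  rewrite -(fineK fS) lee_fin => h.
  have e4 : (2^-1 ^+ n) ^+ 2 = (4 ^+ n)^-1 :> R.
    by rewrite -exprM mulnC exprM -exprVn; congr (_ ^+ n); field.
  rewrite exprMn sqr_sqrtr ?e4 ?ler_pdivlMr ?exprn_gt0//; first by rewrite mulrC.
  by apply: le_trans h; rewrite mulr_ge0 ?normsq_ge0// exprn_ge0.
have K0 n : 0 <= K * 2^-1 ^+ n by rewrite mulr_ge0 ?sqrtr_ge0// exprn_ge0.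
split; apply: (@geometric_step_cvg _ K) => n.
  rewrite -ler_sqr ?nnegrE// (le_trans _ (wK n))// real_normK ?num_real//.
  by rewrite /normsq !reimE -[X in X <= _]sqrrN opprB addrC lerDl sqr_ge0.
rewrite -ler_sqr ?nnegrE// (le_trans _ (wK n))// real_normK ?num_real//.
by rewrite /normsq !reimE -[X in X <= _]sqrrN opprB lerDr sqr_ge0.
Qed.

(** The limit is taken almost everywhere; Fatou's lemma in [m], applied to [|v_n - v_m|^2], keeps
    the constant [8^-n]. *)
Lemma L2_fast_cauchy_cvg (v : nat -> circle R -> R[i]) :
  (forall n, L2 (v n)) ->
  (forall n m, (n <= m)%N ->
    sqnorm (fun z => v n z - v m z) <= 8^-1 ^+ n) ->
  exists2 g, L2 g & forall n, sqnorm (fun z => v n z - g z) <= 8^-1 ^+ n.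
Proof.
move=> Lv v8.
(* The limit exists only almost everywhere, whereas the upper limit is defined and measurable
   everywhere and agrees with it where it exists. *)
pose g z := fine (limn_esup (fun n => (Re (v n z))%:E)) +i*
            fine (limn_esup (fun n => (Im (v n z))%:E)).
have mg : cmeasurable g.
  by split=> /=; apply: measurable_fine_limsup => n; case: (L2_measurable (Lv n)).
have vg : \forall z \ae mu, forall n,
    limn_einf (fun m => (normsq (v n z - v m z))%:E) = (normsq (v n z - g z))%:E.
  have := L2_fast_cauchy_ae_cvg Lv (fun n => v8 _ _ (leqnSn n)).
  apply: filterS => z -[/fine_limsup_cvg cR /fine_limsup_cvg cI] n.
  have cN : normsq (v n z - v m z) @[m --> \oo] --> normsq (v n z - g z).
    rewrite /normsq !reimE !expr2.
    under eq_fun do rewrite !reimE !expr2.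
    by apply: cvgD; apply: cvgM; apply: cvgB => //; exact: cvg_cst.
  by apply: (cvg_limn_einf_sup _).1; apply: cvg_EFin => //; exact: nearW.
have mB n : measurable_fun setT (fun z => normsq (v n z - g z)).
  apply: measurable_normsq; apply: cmeasurableD; first exact: L2_measurable.
  by have := cmeasurableM (cmeasurable_cst (-1)) mg; under eq_fun do rewrite mulN1r.
have key n : (\int[mu]_z (normsq (v n z - g z))%:E <= (8^-1 ^+ n)%:E)%E.
  have mBm m : measurable_fun setT (fun z => (normsq (v n z - v m z))%:E).
    apply/measurable_EFinP/measurable_normsq/L2_measurable; exact: L2B.
  rewrite (@ae_eq_integral _ _ _ mu setT
    (fun z => limn_einf (fun m => (normsq (v n z - v m z))%:E)))//; last 3 first.
  - exact/measurable_EFinP.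
  - rewrite [X in measurable_fun _ X](_ : _ = -%E \o
        (fun z => limn_esup (fun m => (- (normsq (v n z - v m z))%:E)%E)))//.
    apply: measurableT_comp => //; apply: measurable_fun_limn_esup => m.
    exact: measurableT_comp.
  - by apply: filterS vg => z + _ => ->.
  apply: le_trans (fatou _ _ _ _) _ => //.
    by move=> m z _; rewrite lee_fin normsq_ge0.
  rewrite limn_einf_lim; apply: lime_le; first exact: is_cvg_einfs.
  near=> m; apply: (@le_trans _ _ (\int[mu]_z (normsq (v n z - v m z))%:E)%E).
    by apply: ereal_inf_lbound; exists m => /=.
  rewrite -(@fineK _ (\int[mu]_z _)%E); last first.
    by apply: integrable_fin_num => //; apply: L2_normsq; exact: L2B.
  by rewrite lee_fin; apply: v8; near: m; exact: nbhs_infty_ge.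
have Lvg n : L2 (fun z => v n z - g z).
  apply/L2P; split.
    apply: cmeasurableD; first exact: L2_measurable.
    by have := cmeasurableM (cmeasurable_cst (-1)) mg; under eq_fun do rewrite mulN1r.
  apply/integrableP; split; first exact/measurable_EFinP.
  under eq_integral do rewrite /= ger0_norm ?normsq_ge0//.
  by rewrite (le_lt_trans (key n))// ltry.
exists g.
  (* [g] is recovered as [v 0 - (v 0 - g)]. *)
  have := L2B (Lv 0%N) (Lvg 0%N).
  by under eq_fun do rewrite opprB addrC subrK.
move=> n; rewrite -lee_fin fineK; first exact: key.
by apply: integrable_fin_num => //; exact: L2_normsq.
Unshelve. all: by end_near. Qed.

End L2_complete.

(** * Characters of the circle and their orthogonality *)

Section characters.
Context {R : realType}.
Notation mu := (@arclength R).
Notation integrableR q := (mu.-integrable setT (EFin \o q)).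
Implicit Types (f g h : circle R -> R[i]).

(** The integral is pulled back to [[0, 2 pi[], where [F] is a primitive of the integrand taking
    equal values at both ends. *)
Lemma Rintegral_arclength_eq0 (q : circle R -> R) (f F : R -> R) :
  measurable_fun setT q -> (forall t, q (expi t) = f t) ->
  (forall t, `|f t| <= 1) -> continuous f ->
  (forall t : R, is_derive t 1 F (f t)) -> F (2 * pi) = F 0 ->
  \int[mu]_z q z = 0.
Proof.
move=> mq qf f1 cf dF F2pi.
have pi2 : 0 < 2 * pi :> R by rewrite mulr_gt0// pi_gt0.
set D := `[0, 2 * pi[%classic : set (measurableTypeR R).
have mD : measurable D by exact: measurable_itv.
pose nu := mrestr (@lebesgue_measure R) mD.
have nuT : nu setT = (2 * pi)%:E.
  by rewrite /nu /mrestr setTI lebesgue_measure_itv/= lte_fin pi2 sube0.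
have qfE : q \o @expi R = f by apply/funext => t /=; rewrite qf.
have mf : measurable_fun setT f by exact: continuous_measurable_fun.
have if_ : nu.-integrable setT (EFin \o f).
  apply: measurable_bounded_integrable => //; first by rewrite [X in (X < _)%E]nuT ltry.
  by exists 1; split => // x x1 t _ /=; rewrite (le_trans (f1 t))// ltW.
suff : (\int[mu]_z (q z)%:E = 0)%E by rewrite /Rintegral => ->.
have -> : (\int[mu]_z (q z)%:E = \int[nu]_t (f t)%:E)%E.
  rewrite -qfE -(preimage_setT (@expi R)).
  apply: (integral_pushforward (measurable_expi (R := R)) (mu := nu)
    (f := EFin \o q)) => //.
  - exact/measurable_EFinP.
  - by rewrite preimage_setT -compA qfE.
have mND : measurable (~` D) by exact: measurableC.
have nuD : nu (~` D) = 0%E.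
  by rewrite -(measure0 (@lebesgue_measure R)) -(setICl D).
rewrite (negligible_integral mND measurableT if_ nuD).
rewrite setTD setCK.
rewrite (@eq_measure_integral _ _ _ _ (@lebesgue_measure R)); last first.
  by move=> A mA AD; rewrite -[in RHS](setIidl AD).
(* The fundamental theorem of calculus is stated on a closed interval; the added endpoint is
   null. *)
rewrite integral_itv_bndo_bndc; last by exact/measurable_EFinP/measurable_funTS.
rewrite (@continuous_FTC2 _ f F) ?F2pi ?subee//.
- by apply: continuous_subspaceT.
- have cF : continuous F.
    by move=> t; apply/differentiable_continuous/derivable1_diffP; case: (dF t).
  split=> [t _||]; [by case: (dF t)| |].
  + by apply: cvg_at_right_filter; exact: cF.
  + by apply: cvg_at_left_filter; exact: cF.
- by move=> t _; rewrite derive1E; case: (dF t).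
Qed.

Definition chi (n : int) : circle R -> R[i] := fun z => val z ^ n.

Lemma normsq_val (z : circle R) : normsq (val z) = 1.
Proof.
have /eqP := valP z; rewrite normc_def => /(congr1 (@complex.Re R)) /= h.
rewrite -[RHS](expr1n _ 2) -h sqr_sqrtr//; exact: normsq_ge0.
Qed.

Lemma val_circle_neq0 (z : circle R) : val z != 0.
Proof. by rewrite -normsq_eq0 normsq_val oner_eq0. Qed.

Lemma conj_val (z : circle R) : (val z)^*%C = (val z)^-1.
Proof.
apply: (mulfI (val_circle_neq0 z)).
by rewrite mul_conj normsq_val divff ?val_circle_neq0.
Qed.

Lemma chi_conj n z : (chi n z)^*%C = chi (- n) z.
Proof.
rewrite /chi; case: n => n; rewrite ?NegzE ?opprK -?exprz_inv.
  by rewrite -conj_val -!exprnP rmorphXn.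
by rewrite -!exprnP rmorphXn/= -conj_val conjcK.
Qed.

Lemma chiD m n z : chi (m + n) z = chi m z * chi n z.
Proof. by rewrite /chi expfzDr// val_circle_neq0. Qed.

Lemma chi0 z : chi 0 z = 1. Proof. by rewrite /chi expr0z. Qed.

Lemma chi1 z : chi 1 z = val z. Proof. by rewrite /chi expr1z. Qed.

Lemma normsq_chi n z : normsq (chi n z) = 1.
Proof.
apply: (@complexI R).
by rewrite -mul_conj chi_conj -chiD subrr chi0.
Qed.

Lemma cmeasurable_chi n : cmeasurable (chi n).
Proof.
have chin m : cmeasurable (chi (Posz m)).
  elim: m => [|m IH]; first by rewrite (_ : chi _ = fun=> 1)//;
    exact: cmeasurable_cst.
  rewrite (_ : chi _ = fun z => val z * chi m z).
    by apply: cmeasurableM => //; exact: cmeasurable_val.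
  by apply/funext => z; rewrite /chi -!exprnP exprS.
case: n => // n.
rewrite (_ : chi _ = fun z => (chi n.+1 z)^*%C); first exact: cmeasurable_conj.
by apply/funext => z; rewrite chi_conj NegzE.
Qed.

Lemma L2_chi_mul n f : L2 f -> L2 (fun z => chi n z * f z).
Proof.
apply: (@L2_bounded_mul _ 1); first exact: cmeasurable_chi.
by apply: aeW => z; rewrite normsq_chi.
Qed.

Lemma L2_chi n : L2 (chi n).
Proof.
by have := L2_chi_mul n (L2_cst 1); under eq_fun do rewrite mulr1.
Qed.

Lemma de_moivre (t : R) n :
  val (expi t) ^+ n = cos (n%:R * t) +i* sin (n%:R * t).
Proof.
elim: n => [|n IH]; first by rewrite mul0r cos0 sin0.
rewrite exprSr IH; apply: complex_ext; rewrite !reimE /=.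
  by rewrite mulrSr mulrDl mul1r cosD.
by rewrite mulrSr mulrDl mul1r sinD addrC [X in _ + X]mulrC mulrC.
Qed.

(** For a positive index, [cos (n t)] and [sin (n t)] have primitives of period [2 pi]; a negative
    index follows by conjugation. *)
Lemma cintegral_chi n : n != 0 -> cintegral (chi n) = 0.
Proof.
have dl (m : nat) (t : R) : is_derive t 1 (fun t => m%:R * t) m%:R.
  by apply: (is_derive_eq (is_deriveZ m%:R (is_derive_id t 1)));
    rewrite /GRing.scale/= mulr1.
have key (m : nat) : (0 < m)%N -> cintegral (chi m) = 0.
  move=> m0; have mR : m%:R != 0 :> R by rewrite pnatr_eq0 -lt0n.
  have e2 : m%:R * (2 * pi) = 0 + pi *+ 2 *+ m :> R.
    by rewrite add0r !mulr_natl.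
  have [mr mi] := cmeasurable_chi m.
  apply: complex_ext => /=.
    apply: (@Rintegral_arclength_eq0 _ (fun t => cos (m%:R * t))
      (fun t => m%:R^-1 * sin (m%:R * t))) => //.
    - by move=> t; rewrite ?/chi -?exprnP de_moivre.
    - by move=> t; rewrite cos_max.
    - move=> t; apply: continuous_comp; last exact: continuous_cos.
      by apply: cvgM; [exact: cvg_cst|exact: cvg_id].
    - move=> t; apply: (is_derive_eq (is_deriveZ m%:R^-1
        (is_derive1_comp (is_derive_sin _) (dl m t)))).
      by rewrite /GRing.scale/=; field.
    - by rewrite mulr0 e2 (periodicn (@sinD2pi R)).
  apply: (@Rintegral_arclength_eq0 _ (fun t => sin (m%:R * t))
    (fun t => - m%:R^-1 * cos (m%:R * t))) => //.
  - by move=> t; rewrite ?/chi -?exprnP de_moivre.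
  - by move=> t; rewrite sin_max.
  - move=> t; apply: continuous_comp; last exact: continuous_sin.
    by apply: cvgM; [exact: cvg_cst|exact: cvg_id].
  - move=> t; apply: (is_derive_eq (is_deriveZ (- m%:R^-1)
      (is_derive1_comp (is_derive_cos _) (dl m t)))).
    by rewrite /GRing.scale/=; field.
  - by rewrite mulr0 e2 (periodicn (@cosD2pi R)).
case: n => [n|n] n0; first by apply: key; rewrite lt0n.
rewrite (_ : chi _ = fun z => (chi n.+1 z)^*%C).
  rewrite cintegral_conj ?key ?conjc0//.
  exact/L2_cintegrable/L2_chi.
by apply/funext => z; rewrite chi_conj NegzE.
Qed.

Lemma fourier_coef_inner f n :
  fourier_coef f n = ((2 * pi)^-1)%:C * inner f (chi n).
Proof.
rewrite /fourier_coef/inner; congr (_ * _).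
by apply: eq_cintegral => z; rewrite chi_conj.
Qed.

Lemma fourier_coef_eq0 f n : fourier_coef f n = 0 <-> inner f (chi n) = 0.
Proof.
rewrite fourier_coef_inner; split => [/eqP|->]; last by rewrite mulr0.
rewrite mulf_eq0 => /predU1P[/(@complexI R)/eqP|/eqP//].
by rewrite invr_eq0 mulf_eq0 pnatr_eq0/= (gt_eqF (pi_gt0 R)).
Qed.

Lemma inner_chi_shift f m n :
  inner (fun z => chi m z * f z) (chi n) = inner f (chi (n - m)).
Proof.
apply: eq_cintegral => z; rewrite !chi_conj opprB chiD mulrA.
by rewrite [chi m z * _]mulrC.
Qed.

Lemma inner_chi m n : m != n -> inner (chi m) (chi n) = 0.
Proof.
move=> mn; rewrite -(@cintegral_chi (m - n)) ?subr_eq0//.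
by apply: eq_cintegral => z; rewrite chi_conj -chiD.
Qed.

End characters.

(** * Closed subspaces and the projection theorem *)

Section projection.
Context {R : realType}.
Notation mu := (@arclength R).
Implicit Types (f g h p w : circle R -> R[i]) (M : set (circle R -> R[i])).

Definition L2_cvg (v : nat -> circle R -> R[i]) g :=
  sqnorm (fun z => v n z - g z) @[n --> \oo] --> (0 : R).

(** The limit is required to be in [L^2] because [sqnorm] is [0] on an infinite integral, so that
    [L2_cvg] alone does not control [g]. *)
Definition closed_subspace M :=
  [/\ M `<=` L2, M (fun=> 0),
      forall c f g, M f -> M g -> M (fun z => c * f z + g z) &
      forall v g, (forall n, M (v n)) -> L2 g -> L2_cvg v g -> M g].

Lemma cvg0_geometric8 (u : R^nat) (C : R) :
  (forall n, 0 <= u n <= C * 8^-1 ^+ n) -> u @ \oo --> (0 : R).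
Proof.
move=> uC; apply: (squeeze_cvgr (f := fun=> 0) (h := fun n => C * 8^-1 ^+ n)).
- by apply: nearW => n; exact: uC.
- exact: cvg_cst.
- apply: cvg_geometric; rewrite ger0_norm ?invr_ge0//.
  by rewrite invf_lt1// ltr1n.
Qed.

(** By Cauchy-Schwarz the inner product is continuous in its first argument. *)
Lemma L2_cvg_inner0 v g h : (forall n, L2 (v n)) -> L2 g -> L2 h ->
  L2_cvg v g -> (forall n, inner (v n) h = 0) -> inner g h = 0.
Proof.
move=> Lv Lg Lh vg v0; apply/eqP; rewrite -normsq_eq0 eq_le normsq_ge0 andbT.
have : sqnorm (fun z => v n z - g z) * sqnorm h @[n --> \oo] --> 0 * sqnorm h.
  by apply: cvgM => //; exact: cvg_cst.
rewrite mul0r => vg0.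
rewrite -(cvg_lim _ vg0)//; apply: limr_ge; first by apply/cvgP: vg0.
apply: nearW => n; apply: le_trans (cauchy_schwarz _ Lh); last exact: L2B.
by rewrite innerBl// v0 sub0r normsqN.
Qed.

Lemma parallelogram f g : L2 f -> L2 g ->
  sqnorm (fun z => f z - g z) + sqnorm (fun z => f z + g z) =
  2 * sqnorm f + 2 * sqnorm g.
Proof.
move=> Lf Lg; rewrite !sqnormD//; last exact: L2N.
rewrite sqnormN (_ : inner f (fun z => - g z) = - inner f g) ?ReN; first by ring.
rewrite -mulN1r; have := innerZr (-1) Lg Lf; rewrite rmorphN1 => <-.
by congr inner; apply/funext => z; rewrite mulN1r.
Qed.

(* With [c = <f, w>], moving [f] by [c w / |w|^2] lowers [|f|^2] by
   [|c|^2 / |w|^2]. *)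
Lemma almost_orthogonal f w (d eps : R) : L2 f -> L2 w ->
  (forall c, d <= sqnorm (fun z => f z - c * w z)) -> sqnorm f <= d + eps ->
  normsq (inner f w) <= eps * sqnorm w.
Proof.
move=> Lf Lw fd fe; set c := inner f w.
have [w0|w0] := eqVneq (sqnorm w) 0.
  by have := cauchy_schwarz Lf Lw; rewrite w0 !mulr0.
have {}w0 : 0 < sqnorm w by rewrite lt_neqAle eq_sym w0 sqnorm_ge0.
have := fd ((sqnorm w)^-1%:C * c).
rewrite (_ : (fun z => _) = fun z => f z + (- (sqnorm w)^-1%:C * c) * w z); last first.
  by apply/funext => z; rewrite !mulNr.
rewrite sqnormD//; last exact: L2Z.
rewrite sqnormZ// innerZr// -/c normsqM.
rewrite (_ : normsq (- _) = (sqnorm w)^-1 ^+ 2); last by rewrite /normsq /=; ring.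
rewrite (_ : Re _ = - (sqnorm w)^-1 * normsq c); last first.
  by rewrite /normsq !reimE /=; ring.
rewrite (_ : _ + _ + _ = sqnorm f - normsq c / sqnorm w); last first.
  by field; rewrite gt_eqF.
move=> h; rewrite -ler_pdivrMr//; lra.
Qed.

(** A sequence minimizing the distance from [f] to [M] is Cauchy by the parallelogram identity. Its
    terms are almost optimal, hence almost orthogonal to [M], and the limit is exactly so. *)
Lemma projection_exists M f : closed_subspace M -> L2 f ->
  exists p, M p /\ orth_compl M (fun z => f z - p z).
Proof.
move=> [ML2 M0 Mlin Mcl] Lf.
pose S := [set sqnorm (fun z => f z - p z) | p in M].
pose d := inf S.
have S_lb : has_lbound S by exists 0 => _ [p _ <-]; exact: sqnorm_ge0.
have S_inf : has_inf S.
  by split=> //; exists (sqnorm (fun z => f z - 0)); exists (fun=> 0).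
have dP p : M p -> d <= sqnorm (fun z => f z - p z).
  by move=> Mp; apply: ge_inf => //; exists p.
(* With the excess [8^-n / 4], the parallelogram identity bounds [|m_n - m_k|^2] by
   [(8^-n + 8^-k) / 2], the rate that completeness expects. *)
have exm (n : nat) : exists p,
    M p /\ sqnorm (fun z => f z - p z) <= d + 8^-1 ^+ n / 4.
  have e0 : 0 < 8^-1 ^+ n / 4 :> R by rewrite divr_gt0// exprn_gt0// invr_gt0.
  have [_ [p Mp <-] pd] := inf_adherent e0 S_inf.
  by exists p; split => //; exact: ltW.
have [m mP] := choice exm.
have Mm n : M (m n) := (mP n).1.
have Lm n : L2 (m n) := ML2 _ (Mm n).
have Lfm n : L2 (fun z => f z - m n z) by exact: L2B.
have m8 n k : (n <= k)%N -> sqnorm (fun z => m n z - m k z) <= 8^-1 ^+ n.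
  move=> nk; have := parallelogram (Lfm k) (Lfm n).
  rewrite (_ : (fun z => _) = fun z => m n z - m k z); last first.
    by apply/funext => z; ring.
  (* The midpoint is in [M], so its squared distance to [f] is at least [d]. *)
  pose q z := 2^-1 * m n z + 2^-1 * m k z.
  have Mq : M q.
    rewrite /q; apply: (Mlin _ _ (fun z => 2^-1 * m k z)) => //.
    by have := Mlin 2^-1 _ _ (Mm k) M0; under eq_fun do rewrite addr0.
  rewrite (_ : (fun z => f z - m k z + _) = fun z => 2 * (f z - q z)); last first.
    by apply/funext => z; rewrite /q; field.
  rewrite sqnormZ; last by apply: L2B => //; exact: ML2.
  rewrite (_ : normsq 2 = 4 :> R); last by rewrite /normsq /=; ring.
  have := dP _ Mq; have := (mP n).2; have := (mP k).2.
  have : 8^-1 ^+ k <= 8^-1 ^+ n :> R.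
    by rewrite ler_wiXn2l// ?invr_ge0// invf_le1// ler1n.
  lra.
have [g Lg mg] := L2_fast_cauchy_cvg Lm m8.
have mgcvg : L2_cvg m g.
  apply: (@cvg0_geometric8 _ 1) => n.
  by rewrite sqnorm_ge0 mul1r mg.
exists g; split; first exact: Mcl mgcvg.
split; first exact: L2B.
move=> w Mw; have Lw := ML2 _ Mw.
apply/eqP; rewrite -normsq_eq0.
(* The two errors below contribute [1/2] and [2] times [8^-n |w|^2]; the constant [5] leaves
   room. *)
have h n : 0 <= normsq (inner (fun z => f z - g z) w) <= (5 * sqnorm w) * 8^-1 ^+ n.
  rewrite normsq_ge0/=.
  have -> : inner (fun z => f z - g z) w =
      inner (fun z => f z - m n z) w + inner (fun z => m n z - g z) w.
    by rewrite -innerDl//; [congr inner; apply/funext => z; ring|exact: L2B].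
  apply: le_trans (normsqD_le _ _) _.
  have h1 : normsq (inner (fun z => f z - m n z) w) <= 8^-1 ^+ n / 4 * sqnorm w.
    apply: (@almost_orthogonal _ _ d) => //; last exact: (mP n).2.
    move=> c; rewrite (_ : (fun z => _) = fun z => f z - (c * w z + m n z)).
      by apply: dP; exact: Mlin.
    by apply/funext => z; ring.
  have h2 := cauchy_schwarz (L2B (Lm n) Lg) Lw.
  have h3 : sqnorm (fun z => m n z - g z) * sqnorm w <= 8^-1 ^+ n * sqnorm w.
    by rewrite ler_wpM2r ?sqnorm_ge0.
  have h4 : 0 <= 8^-1 ^+ n * sqnorm w.
    by rewrite mulr_ge0 ?sqnorm_ge0// exprn_ge0// invr_ge0.
  lra.
have /cvg_lim <-// := cvg0_geometric8 h.
by rewrite lim_cst.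
Qed.

Lemma orth_projP M f : closed_subspace M -> L2 f ->
  M (orth_proj M f) /\ orth_compl M (fun z => f z - orth_proj M f z).
Proof.
move=> clM Lf; rewrite /orth_proj.
by case: xgetP => [p -> //|]; have [p Mp] := projection_exists clM Lf; move=> /(_ p).
Qed.

Lemma closed_subspaceI M N : closed_subspace M -> closed_subspace N ->
  closed_subspace (M `&` N).
Proof.
move=> [M1 M2 M3 M4] [N1 N2 N3 N4]; split.
- by move=> f [/M1].
- by split.
- by move=> c f g [Mf Nf] [Mg Ng]; split; [exact: M3|exact: N3].
- move=> v g MNv Lg vg; split; [apply: M4 vg|apply: N4 vg] => // n.
    by case: (MNv n).
  by case: (MNv n).
Qed.

(** The common source of closedness for [hardy], for [vanishes_on E], and for the subspace used in
    boundary uniqueness. *)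
Lemma closed_subspace_inner0 (H : set (circle R -> R[i])) : H `<=` L2 ->
  closed_subspace [set f | L2 f /\ forall h, H h -> inner f h = 0].
Proof.
move=> HL2; split.
- by move=> f [].
- split=> [|h /HL2 Lh]; first exact: L2_cst.
  exact: inner0l.
- move=> c f g [Lf f0] [Lg g0]; split; first by apply: L2D => //; exact: L2Z.
  move=> h Hh; have Lh := HL2 _ Hh.
  by rewrite innerDl ?innerZl ?f0 ?g0 ?mulr0 ?addr0//; exact: L2Z.
- move=> v g vH Lg vg; split=> // h Hh; apply: (L2_cvg_inner0 _ Lg _ vg).
  + by move=> n; case: (vH n).
  + exact: HL2.
  + by move=> n; apply: (vH n).2.
Qed.

Lemma hardyE :
  hardy = [set f : circle R -> R[i] | L2 f /\
    forall h, [set chi n | n in [set n : int | n < 0]] h -> inner f h = 0].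
Proof.
apply/seteqP; split=> f [Lf f0]; split=> //.
  by move=> _ [n n0 <-]; apply/fourier_coef_eq0/f0.
by move=> n n0; apply/fourier_coef_eq0/f0; exists n.
Qed.

Lemma closed_subspace_hardy : closed_subspace (@hardy R).
Proof.
by rewrite hardyE; apply: closed_subspace_inner0 => _ [n _ <-]; exact: L2_chi.
Qed.

Definition restr (E : set (circle R)) f : circle R -> R[i] :=
  fun z => (\1_E z)%:C * f z.

Lemma L2_restr E f : measurable E -> L2 f -> L2 (restr E f).
Proof.
move=> mE; apply: (@L2_bounded_mul _ 1).
  by apply: cmeasurable_real; exact: measurable_indic.
apply: aeW => z; rewrite /normsq/= indicE.
by case: (z \in E); rewrite ?expr1n ?expr0n/= ?addr0.
Qed.

Definition vanishes_on (E : set (circle R)) : set (circle R -> R[i]) :=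
  [set f | L2 f /\ \forall z \ae mu, E z -> f z = 0].

(** Testing [f] against its own restriction to [E] gives the integral of [|f|^2] over [E]. This form
    yields closedness. *)
Lemma vanishes_onE E : measurable E -> vanishes_on E =
  [set f | L2 f /\ forall h, [set restr E g | g in L2] h -> inner f h = 0].
Proof.
move=> mE; apply/seteqP; split=> f [Lf f0]; split=> //.
  move=> _ [g Lg <-]; rewrite -[RHS]cintegral0; apply: ae_eq_cintegral.
  - by apply/cintegrable_measurable/cintegrable_inner => //; exact: L2_restr.
  - exact: cmeasurable_cst.
  - apply: filterS f0 => z f0 _; rewrite /restr indicE.
    have [zE|zE] := boolP (z \in E); first by rewrite f0 ?mul0r//; exact: set_mem.
    by rewrite mul0r conjc0 mulr0.
have LEf := L2_restr mE Lf.
have : inner f (restr E f) = (sqnorm (restr E f))%:C.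
  rewrite -inner_sqnorm; apply: eq_cintegral => z; rewrite /restr indicE.
  by case: (z \in E); rewrite ?mul1r// !mul0r conjc0 mulr0.
rewrite f0; last by exists f.
move=> /(@complexI R)/esym/(sqnorm_eq0 LEf); apply: filterS => z /(_ I).
by move=> + /mem_set zE; rewrite /restr indicE zE mul1r.
Qed.

Lemma closed_subspace_vanishes_on E : measurable E ->
  closed_subspace (vanishes_on E).
Proof.
move=> mE; rewrite vanishes_onE//.
by apply: closed_subspace_inner0 => _ [g Lg <-]; exact: L2_restr.
Qed.

End projection.

(** * Uniqueness of Fourier coefficients in L^1 *)

Section step_approximation.
Context {R : realType}.
Implicit Types (u r s y : R) (n N : nat).

Lemma bernoulli_ge y N : 0 <= y -> 1 + N%:R * y <= (1 + y) ^+ N.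
Proof.
move=> y0; elim: N => [|N IH]; first by rewrite mul0r addr0 expr0.
rewrite exprS (le_trans _ (ler_wpM2l _ IH)) ?addr_ge0//.
rewrite -subr_ge0 mulrSr (_ : _ - _ = N%:R * y ^+ 2); last by ring.
by rewrite mulr_ge0// sqr_ge0.
Qed.

Lemma bernoulli_le y N : 0 <= y <= 1 -> 1 - N%:R * y <= (1 - y) ^+ N.
Proof.
move=> /andP[y0 y1]; elim: N => [|N IH]; first by rewrite mul0r subr0 expr0.
rewrite exprS (le_trans _ (ler_wpM2l _ IH)) ?subr_ge0//.
rewrite -subr_ge0 mulrSr (_ : _ - _ = N%:R * y ^+ 2); last by ring.
by rewrite mulr_ge0// sqr_ge0.
Qed.

(** For [s < 1], the geometric sum [(1 - s^n) / (1 - s)] has [n] terms, each at least [s^n]. *)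
Lemma natM_expr_bounded s n : 0 <= s <= 1 -> n%:R * s ^+ n * (1 - s) <= 1 - s ^+ n.
Proof.
move=> /andP[s0 s1]; elim: n => [|n IH]; first by rewrite expr0 !mul0r subrr.
have h := ler_wpM2l s0 IH.
have sn : s ^+ n.+1 <= 1 by rewrite exprn_ile1.
have : 0 <= (1 - s) * (1 - s ^+ n.+1) by rewrite mulr_ge0 ?subr_ge0.
rewrite mulrSr !exprS in h sn *; lra.
Qed.

Lemma cvg_natM_expr r : 0 <= r < 1 -> n%:R * r ^+ n @[n --> \oo] --> (0 : R).
Proof.
(* Since [r^n = s^n * s^n], one factor absorbs [n] and the other still tends to [0]. *)
move=> /andP[r0 r1]; pose s := Num.sqrt r.
have s0 : 0 <= s by exact: sqrtr_ge0.
have s1 : s < 1 by rewrite -sqrtr1 ltr_sqrt.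
have sB : 0 < 1 - s by rewrite subr_gt0.
apply: (squeeze_cvgr (f := fun=> 0) (h := fun n => (1 - s)^-1 * s ^+ n)).
- apply: nearW => n; rewrite mulr_ge0 ?exprn_ge0//=.
  rewrite -(sqr_sqrtr r0) -/s -exprM mulnC exprM expr2 mulrA ler_wpM2r ?exprn_ge0//.
  rewrite -[leRHS]mul1r ler_pdivlMr//.
  have := @natM_expr_bounded s n; rewrite s0 ltW// => /(_ isT).
  by have := exprn_ge0 n s0; lra.
- exact: cvg_cst.
- by apply: cvg_geometric; rewrite ger0_norm.
Qed.

(* The exponent [n * 2 ^ n] makes [n * 2 ^ n * u ^ n] tend to [0] for [u < 1/2]
   and to infinity for [u >= 1/2], the value [1/2] included. *)
Definition step_poly n u := (1 - u ^+ n) ^+ (n * 2 ^ n).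

Lemma step_poly_itv n u : 0 <= u <= 1 -> 0 <= step_poly n u <= 1.
Proof.
move=> /andP[u0 u1]; have un : 0 <= 1 - u ^+ n <= 1.
  by rewrite subr_ge0 exprn_ile1//= lerBlDr lerDl exprn_ge0.
by case/andP: un => un0 un1; rewrite /step_poly exprn_ge0//= exprn_ile1.
Qed.

Lemma cvg_step_poly u : 0 <= u <= 1 ->
  step_poly n u @[n --> \oo] --> (if u < 2^-1 then 1 else 0 : R).
Proof.
move=> u01; have /andP[u0 u1] := u01.
have [u2|u2] := ltP u 2^-1.
  apply: (squeeze_cvgr (f := fun n => 1 - n%:R * (2 * u) ^+ n) (h := fun=> 1)).
  - apply: nearW => n; have /andP[_ ->] := step_poly_itv n u01.
    rewrite andbT exprMn mulrA -natrX -natrM; apply: bernoulli_le.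
    by rewrite exprn_ge0//= exprn_ile1.
  - rewrite -[X in _ --> X](subr0 1); apply: cvgB; first exact: cvg_cst.
    by apply: cvg_natM_expr; lra.
  - exact: cvg_cst.
apply: (squeeze_cvgr (f := fun=> 0) (h := harmonic)).
- apply: nearW => n; have /andP[-> _] /= := step_poly_itv n u01.
  pose t : R := 2^-1 ^+ n.
  have t0 : 0 <= t by rewrite exprn_ge0 ?invr_ge0.
  have t1 : t <= 1 by rewrite exprn_ile1 ?invr_ge0// invf_le1// ler1n.
  have tu : t <= u ^+ n by rewrite lerXn2r// ?nnegrE ?invr_ge0.
  apply: (@le_trans _ _ ((1 - t) ^+ (n * 2 ^ n))).
    rewrite lerXn2r ?nnegrE ?subr_ge0//; first by rewrite exprn_ile1.
    lra.
  (* With [N = n * 2^n] and [t = 2^-n], Bernoulli gives [(1 + t)^N >= 1 + n], while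
     [(1 - t)^N (1 + t)^N <= 1]; hence the bound [1 / (n + 1)]. *)
  have := @bernoulli_ge t (n * 2 ^ n) t0.
  rewrite natrM natrX -mulrA -exprMn divff ?expr1n ?mulr1 ?pnatr_eq0// => h.
  rewrite -[leRHS]mul1r ler_pdivlMr ?ltr0n// -[n.+1]add1n natrD.
  apply: le_trans (ler_wpM2l _ h) _; first by rewrite exprn_ge0 ?subr_ge0.
  rewrite -exprMn exprn_ile1//; first by rewrite mulr_ge0 ?subr_ge0 ?addr_ge0.
  have := sqr_ge0 t; lra.
- exact: cvg_cst.
- exact: cvg_harmonic.
Qed.

End step_approximation.

(** * From Fourier coefficients to integrals over measurable sets *)

Section fourier_uniqueness.
Context {R : realType}.
Notation mu := (@arclength R).
Notation integrableR q := (mu.-integrable setT (EFin \o q)).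
Implicit Types (h : circle R -> R[i]) (p q x : circle R -> R) (A : set (circle R)).

Lemma cintegrable_bounded_mul h (u : circle R -> R[i]) (C : R) :
  cintegrable h -> cmeasurable u -> (forall z, normsq (u z) <= C) ->
  cintegrable (fun z => h z * u z).
Proof.
move=> ih mu_ uC; have [h1 h2] := ih.
have [m1 m2] := cmeasurableM (cintegrable_measurable ih) mu_.
have iH : integrableR (fun z => (C + 1) * (`|Re (h z)| + `|Im (h z)|)).
  by apply: integrableRZ; apply: integrableRD; exact: integrable_norm.
(* [C] bounds the squared modulus, and [C + 1] bounds the modulus itself without a square root. *)
have le1 (a b c : R) : b ^+ 2 + c ^+ 2 <= C -> `|a * b| <= (C + 1) * `|a|.
  move=> bC; rewrite normrM mulrC ler_wpM2r// ler_norml.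
  have := sqr_ge0 (b - 1); have := sqr_ge0 (b + 1); have := sqr_ge0 c.
  by have := sqr_ge0 b; rewrite !expr2 in bC *; move=> ? ? ? ?; apply/andP; split; nra.
split.
  apply: (le_integrable_ae m1 _ iH); apply: aeW => z; rewrite ReM.
  rewrite (le_trans (ler_normB _ _))// mulrDr lerD//.
    exact: (le1 _ _ (Im (u z)) (uC z)).
  by apply: (le1 _ _ (Re (u z))); rewrite addrC uC.
apply: (le_integrable_ae m2 _ iH); apply: aeW => z; rewrite ImM.
rewrite (le_trans (ler_normD _ _))// mulrDr lerD//.
  by apply: (le1 _ _ (Re (u z))); rewrite addrC uC.
exact: (le1 _ _ (Im (u z)) (uC z)).
Qed.

(* [annihilator h] is stable under multiplication by [Re z] and [Im z], hence by
   polynomials in them and, passing to bounded limits, by indicators of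
   half-planes; these generate the sigma-algebra of the circle. *)
Definition annihilator h : set (circle R -> R) :=
  [set q : circle R -> R | [/\ measurable_fun setT q,
    exists C : R, forall z, `|q z| <= C &
    forall k, cintegral (fun z => h z * ((q z)%:C * chi k z)) = 0]].

Lemma cintegrable_mul_chi h q k (C : R) : cintegrable h ->
  measurable_fun setT q -> (forall z, `|q z| <= C) ->
  cintegrable (fun z => h z * ((q z)%:C * chi k z)).
Proof.
move=> ih mq qC; apply: (@cintegrable_bounded_mul _ _ (C ^+ 2)) => //.
  by apply: cmeasurableM; [exact: cmeasurable_real|exact: cmeasurable_chi].
move=> z; rewrite normsqM normsq_chi mulr1 /normsq/= expr0n addr0.
by rewrite -real_normK ?num_real// lerXn2r ?nnegrE// (le_trans _ (qC z)).
Qed.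

Lemma annihilator_lin h (a b : R) p q : cintegrable h ->
  annihilator h p -> annihilator h q ->
  annihilator h (fun z => a * p z + b * q z).
Proof.
move=> ih [mp [C pC] p0] [mq [D qD] q0]; split.
- by apply: measurable_funD; exact: measurable_funM.
- exists (`|a| * C + `|b| * D) => z.
  by rewrite (le_trans (ler_normD _ _))// !normrM lerD// ler_wpM2l.
- move=> k; pose F r z := h z * ((r z)%:C * chi k z).
  rewrite (_ : (fun z => _) = fun z => a%:C * F p z + b%:C * F q z); last first.
    by apply/funext => z; rewrite /F rmorphD !rmorphM/=; ring.
  have iFp : cintegrable (F p) by exact: cintegrable_mul_chi pC.
  have iFq : cintegrable (F q) by exact: cintegrable_mul_chi qD.
  rewrite cintegralD; [|exact: cintegrableZ|exact: cintegrableZ].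
  by rewrite !cintegralZ// /F p0 q0 !mulr0 addr0.
Qed.

(** Multiplication by such an [x] only shifts the index of the character, and [annihilator]
    quantifies over all indices. *)
Lemma annihilator_mul_coord h q (a : R[i]) x : cintegrable h ->
  measurable_fun setT x -> (forall z, `|x z| <= 1) ->
  (forall z, (x z)%:C = a * chi 1 z + a^*%C * chi (-1) z) ->
  annihilator h q -> annihilator h (fun z => q z * x z).
Proof.
move=> ih mx x1 xE [mq [C qC] q0]; split.
- exact: measurable_funM.
- exists C => z; rewrite normrM (le_trans _ (qC z))// -[leRHS]mulr1.
  exact: ler_wpM2l.
- move=> k; pose F j z := h z * ((q z)%:C * chi j z).
  rewrite (_ : (fun z => _) =
      fun z => a * F (1 + k) z + a^*%C * F (-1 + k) z); last first.
    by apply/funext => z; rewrite /F rmorphM/= xE !chiD; ring.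
  have iF j : cintegrable (F j) by exact: cintegrable_mul_chi qC.
  rewrite cintegralD; [|exact: cintegrableZ|exact: cintegrableZ].
  by rewrite !cintegralZ// /F !q0 !mulr0 addr0.
Qed.

(** Dominated convergence, with a multiple of the modulus of the real or imaginary part of
    [h z * chi k z] as the dominating function. *)
Lemma annihilator_lim h (q_ : nat -> circle R -> R) q (C : R) : cintegrable h ->
  (forall n, annihilator h (q_ n)) -> (forall n z, `|q_ n z| <= C) ->
  (forall z, q_ n z @[n --> \oo] --> q z) -> annihilator h q.
Proof.
move=> ih Aq qC qq.
have mq : measurable_fun setT q.
  apply: (@measurable_fun_cvg _ _ _ _ q_) => [n|z _]; last exact: qq.
  by case: (Aq n).
have qC' z : `|q z| <= C.
  have nq : `|q_ n z| @[n --> \oo] --> `|q z| by apply: cvg_norm; exact: qq.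
  rewrite -(cvg_lim _ nq)//; apply: limr_le; first by apply/cvgP: nq.
  by apply: nearW => n; exact: qC.
split => //; first by exists C.
move=> k.
pose F r z := h z * ((r z)%:C * chi k z).
have iF n : cintegrable (F (q_ n)).
  by have [mqn _ _] := Aq n; exact: cintegrable_mul_chi (qC n).
have [iF1 iF2] : cintegrable (F q) by exact: cintegrable_mul_chi qC'.
have [h1 h2] : cintegrable (fun z => h z * chi k z).
  apply: (@cintegrable_bounded_mul _ _ 1) => //; first exact: cmeasurable_chi.
  by move=> z; rewrite normsq_chi.
have FE r z : F r z = (r z)%:C * (h z * chi k z) by rewrite /F; ring.
have ReF r z : Re (F r z) = r z * Re (h z * chi k z).
  by rewrite FE ReM /= mul0r subr0.
have ImF r z : Im (F r z) = r z * Im (h z * chi k z).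
  by rewrite FE ImM /= mul0r addr0.
(* Abstracting the real-valued integrand as [r z * g z] lets one argument serve both parts. *)
have dom (g : circle R -> R) (G : (circle R -> R) -> circle R -> R) :
    integrableR g -> (forall r z, G r z = r z * g z) ->
    (forall n, integrableR (G (q_ n))) -> integrableR (G q) ->
    (forall n, \int[mu]_z G (q_ n) z = 0) -> \int[mu]_z G q z = 0.
  move=> ig GE iGn iGq G0.
  have cv : \forall z \ae mu, setT z ->
      (EFin \o G (q_ n)) z @[n --> \oo] --> (EFin \o G q) z.
    apply: aeW => z _; apply: cvg_EFin; first exact: nearW.
    rewrite /= GE; under eq_fun do rewrite /= GE.
    by apply: cvgM; [exact: qq|exact: cvg_cst].
  have bd : \forall z \ae mu, forall n, setT z ->
      (`|(EFin \o G (q_ n)) z| <= (EFin \o (fun z => C * `|g z|)%R) z)%E.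
    by apply: aeW => z n _ /=; rewrite lee_fin GE normrM ler_wpM2r.
  have [_ _] := dominated_convergence measurableT
    (fun n => measurable_int _ (iGn n)) (measurable_int _ iGq) cv
    (integrableRZ C (integrable_norm ig)) bd.
  have I0 n : (\int[mu]_z (EFin \o G (q_ n)) z = 0)%E.
    rewrite -(@fineK _ (\int[mu]_z _)%E); last exact: integrable_fin_num.
    by congr EFin; exact: G0.
  under eq_fun do rewrite I0.
  by move=> H; rewrite /Rintegral -[X in fine X](cvg_lim _ H)// lim_cst.
have F0 n : cintegral (F (q_ n)) = 0 by case: (Aq n) => _ _; exact.
apply: complex_ext.
  apply: (dom _ (fun r z => Re (F r z)) h1 ReF) => //.
    by move=> n; case: (iF n).
  by move=> n; have /(congr1 (@complex.Re R)) := F0 n.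
apply: (dom _ (fun r z => Im (F r z)) h2 ImF) => //.
  by move=> n; case: (iF n).
by move=> n; have /(congr1 (@complex.Im R)) := F0 n.
Qed.

Lemma annihilator_mulX h q x n : annihilator h q ->
  (forall q', annihilator h q' -> annihilator h (fun z => q' z * x z)) ->
  annihilator h (fun z => q z * x z ^+ n).
Proof.
move=> Aq Ax; elim: n => [|n IH].
  by under eq_fun do rewrite expr0 mulr1.
by under eq_fun do rewrite exprSr mulrA; exact: Ax.
Qed.

(** The indicator of [x > a] is the pointwise limit of [step_poly n u], where [u] is affine in [x]
    and less than [1/2] exactly when [x > a]. *)
Lemma annihilator_halfspace h x (a : R) : cintegrable h ->
  (forall z, `|x z| <= 1) ->
  (forall q, annihilator h q -> annihilator h (fun z => q z * x z)) ->
  forall q, annihilator h q ->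
  annihilator h (fun z => q z * \1_(x @^-1` `]a, +oo[%classic) z).
Proof.
move=> ih x1 Ax q Aq; have [_ [C qC] _] := Aq.
(* Since [|x - a| <= 1 + |a|], this scaling keeps [u = 1/2 - c (x - a)] in [[0, 1]]. *)
pose c : R := (2 * (1 + `|a|))^-1.
have a0 := normr_ge0 a.
have c0 : 0 < c by rewrite invr_gt0 mulr_gt0// ltr_wpDr.
pose u z := 2^-1 + c * a - c * x z.
have cE : c * (2 * (1 + `|a|)) = 1 by rewrite mulVf// gt_eqF// mulr_gt0// ltr_wpDr.
have u01 z : 0 <= u z <= 1.
  have : `|x z - a| <= 1 + `|a| by rewrite (le_trans (ler_normB _ _))// lerD.
  rewrite ler_norml => /andP[xl xr].
  have := ler_wpM2l (ltW c0) xl; have := ler_wpM2l (ltW c0) xr.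
  by rewrite /u; lra.
have uE z : (u z < 2^-1) = (a < x z).
  rewrite /u; apply/idP/idP => [ux|ax].
    by rewrite -(ltr_pM2l c0); lra.
  by have := ltr_pM2l c0 a (x z); rewrite ax => cax; move: cax; lra.
have Au q' : annihilator h q' -> annihilator h (fun z => q' z * u z).
  move=> Aq'.
  rewrite (_ : (fun z => _) = fun z => (2^-1 + c * a) * q' z + (- c) * (q' z * x z)).
    by apply: annihilator_lin => //; exact: Ax.
  by apply/funext => z; rewrite /u; ring.
have A1u n q' : annihilator h q' -> annihilator h (fun z => q' z * (1 - u z ^+ n)).
  move=> Aq'.
  rewrite (_ : (fun z => _) = fun z => 1 * q' z + (- 1) * (q' z * u z ^+ n)).
    by apply: annihilator_lin => //; exact: annihilator_mulX.
  by apply/funext => z; ring.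
apply: (@annihilator_lim _ (fun n z => q z * step_poly n (u z)) _ C ih).
- by move=> n; apply: annihilator_mulX => // q'; exact: A1u.
- move=> n z; have /andP[s0 s1] := step_poly_itv n (u01 z).
  by rewrite normrM (le_trans _ (qC z))// -[leRHS]mulr1 ler_wpM2l// ger0_norm.
- move=> z; apply: cvgM; first exact: cvg_cst.
  have := cvg_step_poly (u01 z); rewrite uE indicE.
  suff -> : (z \in x @^-1` `]a, +oo[%classic) = (a < x z) by case: (a < x z).
  by apply/idP/idP; rewrite inE/= in_itv/= andbT.
Qed.

(** Asking for stability under multiplication by the indicator, rather than for membership of the
    indicator, makes intersections immediate. *)
Definition annihilating_set h : set (set (circle R)) :=
  [set A | measurable A /\
    forall q, annihilator h q -> annihilator h (fun z => q z * \1_A z)].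

Lemma annihilating_setI h A B : annihilating_set h A -> annihilating_set h B ->
  annihilating_set h (A `&` B).
Proof.
move=> [mA hA] [mB hB]; split; first exact: measurableI.
move=> q /hA /hB; congr annihilator; apply/funext => z.
by rewrite -mulrA; congr (_ * _); rewrite indicI.
Qed.

Lemma sigma_algebra_annihilating_set h : cintegrable h ->
  sigma_algebra setT (annihilating_set h).
Proof.
move=> ih; have hC A : annihilating_set h A -> annihilating_set h (~` A).
  move=> [mA hA]; split; first exact: measurableC.
  move=> q Aq.
  rewrite (_ : (fun z => _) = fun z => 1 * q z + (- 1) * (q z * \1_A z)).
    by apply: annihilator_lin => //; exact: hA.
  apply/funext => z; rewrite !indicE in_setC.
  by case: (z \in A) => /=; ring.
have A0 : annihilating_set h set0.
  split => // q Aq; rewrite (_ : (fun z => _) = fun z => 0 * q z + 0 * q z).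
    exact: annihilator_lin.
  by apply/funext => z; rewrite indic0 !(mul0r,mulr0) addr0.
split => // [A /hC|F hF]; first by rewrite setTD.
(* The complement of the union is the decreasing limit of finite intersections of complements, to
   which bounded limits apply. *)
rewrite -[X in annihilating_set h X]setCK; apply/hC.
split.
  by apply: measurableC; apply: bigcup_measurable => n _; case: (hF n).
move=> q Aq; have [_ [C qC] _] := Aq.
pose G n := ~` \bigcup_(i in `I_n) F i.
have hG n : annihilating_set h (G n).
  rewrite /G setC_bigcup; elim: n => [|n IH].
    by rewrite II0 bigcap_set0 -setC0; exact: hC.
  by rewrite IIS bigcap_setU bigcap_set1; apply: annihilating_setI => //; exact: hC.
apply: (@annihilator_lim _ (fun n z => q z * \1_(G n) z) _ C ih).
- by move=> n; apply: (hG n).2.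
- move=> n z; rewrite normrM (le_trans _ (qC z))// -[leRHS]mulr1 ler_wpM2l//.
  by rewrite indicE; case: (z \in _); rewrite ?normr1 ?normr0.
- move=> z; apply: cvgM; first exact: cvg_cst.
  (* At each point the indicators are eventually constant: they are [0] from [k + 1] on if [z] is in
     [F k], and always [1] if it is in no [F k]. *)
  apply: cvg_near_cst.
  have [[k _ Fkz]|nF] := pselect ((\bigcup_i F i) z).
    exists k.+1 => // n /= kn.
    rewrite !indicE !memNset//; first by move=> /(_ _); apply; exists k.
    by apply; exists k.
  apply: nearW => n; rewrite !indicE !mem_set//.
  by move=> [k _ Fkz]; apply: nF; exists k.
Qed.

Lemma annihilating_set_coord h x : cintegrable h ->
  measurable_fun setT x -> (forall z, `|x z| <= 1) ->
  (forall q, annihilator h q -> annihilator h (fun z => q z * x z)) ->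
  forall B, measurable B -> annihilating_set h (x @^-1` B).
Proof.
move=> ih mx x1 Ax.
suff H : (@measurable _ (measurableTypeR R)) `<=`
    image_set_system setT x (annihilating_set h).
  by move=> B /H; rewrite /image_set_system/= setTI.
rewrite [X in X `<=` _](RGenOInfty.measurableE R).
apply: smallest_sub; first exact/sigma_algebra_image/sigma_algebra_annihilating_set.
move=> _ [a ->]; rewrite /image_set_system/= setTI; split.
  by rewrite -[X in measurable X]setTI; apply: mx => //; exact: measurable_itv.
exact: annihilator_halfspace.
Qed.

Lemma normRe_val_le1 (z : circle R) : `|Re (val z)| <= 1.
Proof.
have := normsq_val z; rewrite /normsq => h.
have := sqr_ge0 (Im (val z)) => i0.
by rewrite -(expr_le1 (n := 2))// real_normK ?num_real//; lra.
Qed.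

Lemma normIm_val_le1 (z : circle R) : `|Im (val z)| <= 1.
Proof.
have := normsq_val z; rewrite /normsq => h.
have := sqr_ge0 (Re (val z)) => i0.
by rewrite -(expr_le1 (n := 2))// real_normK ?num_real//; lra.
Qed.

(** Measurable sets of the circle are traces of Borel sets of the plane, which rectangles generate;
    a rectangle is an intersection of conditions on the two coordinates. *)
Lemma annihilating_setT h A : cintegrable h -> measurable A -> annihilating_set h A.
Proof.
move=> ih [B mB <-]; rewrite setTI.
have [mRe mIm] := @cmeasurable_val R.
(* The coefficients come from [Re z = (z + 1/z) / 2] and [Im z = (z - 1/z) / (2i)] on the circle. *)
have AR := annihilating_set_coord ih mRe normRe_val_le1
  (fun q => annihilator_mul_coord (a := 2^-1) ih mRe normRe_val_le1 _).
have AI := annihilating_set_coord ih mIm normIm_val_le1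
  (fun q => annihilator_mul_coord (a := - 'i / 2) ih mIm normIm_val_le1 _).
suff H : (@measurable _ (measurableTypeR R * measurableTypeR R)%type) `<=`
    image_set_system setT (@circle_coord R) (annihilating_set h).
  by move: mB => /H; rewrite /image_set_system/= setTI.
rewrite measurable_prod_measurableType.
apply: smallest_sub; first exact/sigma_algebra_image/sigma_algebra_annihilating_set.
move=> _ [B1 mB1 [B2 mB2 <-]]; rewrite /image_set_system/= setTI.
have -> : @circle_coord R @^-1` (B1 `*` B2) =
  (fun z => Re (val z)) @^-1` B1 `&` (fun z => Im (val z)) @^-1` B2 by [].
apply: annihilating_setI.
  apply: AR => // z; rewrite -chi1 -chi_conj.
  by apply: complex_ext; rewrite !reimE /=; field.
apply: AI => // z; rewrite -chi1 -chi_conj.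
by apply: complex_ext; rewrite !reimE /=; field.
Qed.

(** The hypothesis says that the constant [1] annihilates [h]; hence so does every indicator, and
    [h] has integral [0] over every measurable set. *)
Lemma fourier_uniqueness h : cintegrable h ->
  (forall k, cintegral (fun z => h z * chi k z) = 0) -> h = (fun=> 0) %[ae mu].
Proof.
move=> ih h0; have [h1 h2] := ih.
have A1 : annihilator h (fun=> 1).
  split; [exact: measurable_cst|by exists 1 => z; rewrite normr1|move=> k].
  by rewrite -[RHS](h0 k); apply: eq_cintegral => z; rewrite mul1r.
have hA A : measurable A -> cintegral (fun z => h z * (\1_A z)%:C) = 0.
  move=> mA; have [_ _ /(_ 0)] := (annihilating_setT ih mA).2 _ A1.
  by move=> <-; apply: eq_cintegral => z; rewrite chi0 mulr1 mul1r.
have key (g : circle R -> R) : integrableR g ->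
    (forall A, measurable A -> \int[mu]_z (g z * \1_A z) = 0) ->
    g = (fun=> 0) %[ae mu].
  move=> ig g0.
  have := @integral_ae_eq _ _ _ mu setT measurableT (fun=> 0%E) (EFin \o g) ig
    (measurable_cst _) _.
  have H E : E `<=` setT -> measurable E ->
      (\int[mu]_(z in E) (EFin \o g) z = \int[mu]_(z in E) 0)%E.
    move=> _ mE; rewrite integral0 integral_mkcond.
    have e : (EFin \o g) \_ E = EFin \o (fun z => g z * \1_E z).
      apply/funext => z; rewrite patchE /= indicE.
      by case: (z \in E); rewrite ?mulr1 ?mulr0.
    rewrite e -(@fineK _ (\int[mu]_z _)%E); first by congr EFin; exact: g0.
    apply: integrable_fin_num => //; rewrite -e.
    by apply/integrable_restrict => //; rewrite setTI; exact: integrableS ig.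
  by move=> /(_ H); apply: filterS => z /(_ I) [].
have hR := key _ h1; have hI := key _ h2.
have : \forall z \ae mu, Re (h z) = 0.
  apply: filterS (hR _) => [z /(_ I)//|A mA].
  rewrite -[RHS](congr1 (@complex.Re R) (hA _ mA)) /=.
  by apply: eq_Rintegral => z _; rewrite ReM /= mulr0 subr0.
have : \forall z \ae mu, Im (h z) = 0.
  apply: filterS (hI _) => [z /(_ I)//|A mA].
  rewrite -[RHS](congr1 (@complex.Im R) (hA _ mA)) /=.
  by apply: eq_Rintegral => z _; rewrite ImM /= mulr0 add0r.
by apply: filterS2 => z hi hr _; apply: complex_ext.
Qed.

End fourier_uniqueness.

(** * The Hardy space and boundary uniqueness *)

Section hardy_theory.
Context {R : realType}.
Notation mu := (@arclength R).
Notation H2 := (@hardy R).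
Notation H2orth := (orth_compl (@hardy R)).
Implicit Types (f g h u w : circle R -> R[i]) (E : set (circle R)).

Lemma L2_chi_eq0 f : L2 f -> (forall n, inner f (chi n) = 0) ->
  f = (fun=> 0) %[ae mu].
Proof.
move=> Lf f0; apply: fourier_uniqueness; first exact: L2_cintegrable.
move=> k; rewrite -[RHS](f0 (- k)); apply: eq_cintegral => z.
by rewrite chi_conj opprK.
Qed.

Lemma hardy_L2 f : H2 f -> L2 f. Proof. by case. Qed.

Lemma hardy_orth_L2 f : H2orth f -> L2 f. Proof. by case. Qed.

Lemma hardyP f : H2 f <-> L2 f /\ forall n, n < 0 -> inner f (chi n) = 0.
Proof.
by split=> -[Lf f0]; split=> // n n0; apply/fourier_coef_eq0/f0.
Qed.

Lemma hardy_inner_chi f n : H2 f -> n < 0 -> inner f (chi n) = 0.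
Proof. by move=> /hardyP[_]; exact. Qed.

Lemma hardy_chi n : 0 <= n -> H2 (chi n).
Proof.
move=> n0; apply/hardyP; split; first exact: L2_chi.
by move=> m m0; apply: inner_chi; rewrite gt_eqF// (lt_le_trans m0).
Qed.

Lemma hardyB f g : H2 f -> H2 g -> H2 (fun z => f z - g z).
Proof.
have [_ _ lin _] := @closed_subspace_hardy R.
move=> Hf Hg; have := lin (-1) _ _ Hg Hf.
by under eq_fun do rewrite mulN1r addrC.
Qed.

Lemma hardy_orthB f g : H2orth f -> H2orth g -> H2orth (fun z => f z - g z).
Proof.
move=> [Lf f0] [Lg g0]; split; first exact: L2B.
by move=> u Hu; rewrite innerBl ?f0 ?g0 ?subrr//; exact: hardy_L2.
Qed.

Lemma hardy_cap_orth f : H2 f -> H2orth f -> f = (fun=> 0) %[ae mu].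
Proof.
move=> Hf [Lf f0]; apply: sqnorm_eq0 => //; apply: (@complexI R).
by rewrite -inner_sqnorm f0.
Qed.

Lemma hardy_projP f : L2 f -> H2 (P_plus f) /\ H2orth (Q_minus f).
Proof. exact: orth_projP (@closed_subspace_hardy R). Qed.

(** For the converse, [P w] has no negative frequency, being in [H^2], and no other one, because [w]
    and [Q w] have none; so [P w = 0] and [w = Q w] almost everywhere. *)
Lemma hardy_orthP w : H2orth w <-> L2 w /\ forall n, 0 <= n -> inner w (chi n) = 0.
Proof.
split=> [[Lw w0]|[Lw w0]]; first by split => // n n0; exact/w0/hardy_chi.
have [Hp Hq] := hardy_projP Lw; have [Lq q0] := Hq.
have Lp := hardy_L2 Hp.
have p0 : P_plus w = (fun=> 0) %[ae mu].
  apply: L2_chi_eq0 => // n; have [n0|n0] := ltP n 0.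
    exact: hardy_inner_chi.
  have := q0 _ (hardy_chi n0).
  by rewrite innerBl ?w0 ?sub0r//; [move/eqP; rewrite oppr_eq0 => /eqP|exact: L2_chi].
split=> // u Hu; rewrite -(q0 u Hu); apply: ae_eq_inner => //.
  exact: hardy_L2.
by apply: filterS p0 => z /[apply] p0; rewrite /Q_minus p0 subr0.
Qed.

Lemma hardy_orth_chi n : n < 0 -> H2orth (chi n).
Proof.
move=> n0; apply/hardy_orthP; split; first exact: L2_chi.
by move=> m m0; apply: inner_chi; rewrite lt_eqF// (lt_le_trans n0).
Qed.

Lemma hardy_chi_mul n f : 0 <= n -> H2 f -> H2 (fun z => chi n z * f z).
Proof.
move=> n0 /hardyP[Lf f0]; apply/hardyP; split; first exact: L2_chi_mul.
move=> m m0; rewrite inner_chi_shift f0// ltrBlDr add0r; exact: lt_le_trans n0.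
Qed.

Lemma hardy_orth_chi_mul n w : n <= 0 -> H2orth w ->
  H2orth (fun z => chi n z * w z).
Proof.
move=> n0 /hardy_orthP[Lw w0]; apply/hardy_orthP; split; first exact: L2_chi_mul.
by move=> m m0; rewrite inner_chi_shift w0// subr_ge0; exact: le_trans m0.
Qed.

(** Conjugation reverses the sign of frequencies, which transports boundary uniqueness to the
    orthogonal complement. *)
Lemma hardy_orth_conj w : H2orth w -> H2 (fun z => (w z)^*%C).
Proof.
move=> /hardy_orthP[Lw w0]; apply/hardyP; split; first exact: L2_conj.
move=> n n0; rewrite -[RHS]conjc0 -(w0 (- n)) ?oppr_ge0 ?ltW//.
rewrite /inner -cintegral_conj; last exact: cintegrable_inner (L2_chi _).
by apply: eq_cintegral => z; rewrite rmorphM/= !chi_conj opprK.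
Qed.

Lemma not_ae_eq0 E (P : circle R -> Prop) : measurable E -> mu E <> 0%E ->
  (\forall z \ae mu, E z -> P z) -> exists2 z, E z & P z.
Proof.
move=> mE muE aeP; apply: contrapT => nP; apply: muE.
apply: (measure_negligible mE); apply: negligibleS aeP.
by move=> z Ez /= => Pz; apply: nP; exists z => //; exact: Pz.
Qed.

Lemma hardy_vanishing_mean E f : measurable E -> mu E <> 0%E -> H2 f ->
  (\forall z \ae mu, E z -> f z = 0) -> inner f (chi 0) = 0.
Proof.
move=> mE muE /hardyP[Lf f0] fE.
(* The functions of [z H^2] that vanish on [E]: frequency [0] is excluded too. *)
pose V := [set v : circle R -> R[i] | L2 v /\
  forall h, [set chi n | n in [set n : int | n <= 0]] h -> inner v h = 0] `&`
  vanishes_on E.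
have clV : closed_subspace V.
  apply: closed_subspaceI; last exact: closed_subspace_vanishes_on.
  by apply: closed_subspace_inner0 => _ [n _ <-]; exact: L2_chi.
have [[[Lp p0] [_ pE]]] := orth_projP clV Lf.
set p := orth_proj V f in Lp p0 pE *; pose g z := f z - p z.
rewrite -/g => -[Lg gV].
have gE : \forall z \ae mu, E z -> g z = 0.
  by apply: filterS2 fE pE => z fE pE Ez; rewrite /g fE// pE// subrr.
have g0 n : n < 0 -> inner g (chi n) = 0.
  move=> n0; rewrite innerBl//; last exact: L2_chi.
  by rewrite f0// p0 ?subrr//; exists n => //; exact: ltW.
have -> : inner f (chi 0) = inner g (chi 0).
  rewrite innerBl//; last exact: L2_chi.
  by rewrite [inner p _]p0 ?subr0//; exists 0.
(* [g] is in [H^2] and vanishes on [E], so a positive shift puts it in [V], to which [g] is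
   orthogonal. *)
have Vg k : 0 < k -> V (fun z => chi k z * g z).
  move=> k0; have Lkg := L2_chi_mul k Lg; split; split => //.
    move=> _ [n /= n0 <-]; rewrite inner_chi_shift g0// subr_lt0.
    exact: le_lt_trans k0.
  by apply: filterS gE => z gE Ez; rewrite gE// mulr0.
have iN : cintegrable (fun z => (normsq (g z))%:C).
  by apply: cintegrable_real; exact: L2_normsq.
have ng0 k : k < 0 -> cintegral (fun z => (normsq (g z))%:C * chi k z) = 0.
  move=> k0; rewrite -[RHS](gV (fun z => chi (- k) z * g z)).
    by apply: eq_cintegral => z; rewrite rmorphM/= chi_conj opprK -mul_conj; ring.
  by apply: Vg; rewrite oppr_gt0.
(* [c] is the mean of [|g|^2]. The coefficients of [|g|^2] with [k < 0] vanish by [ng0], those with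
   [k > 0] by conjugation, since [|g|^2] is real. *)
pose c : R := sqnorm g / (2 * pi).
have pi2 : 2 * pi != 0 :> R by rewrite mulf_neq0// gt_eqF// pi_gt0.
have ic : cintegrable (fun _ : circle R => - c%:C) by exact/L2_cintegrable/L2_cst.
have iNk k : cintegrable (fun z => (normsq (g z))%:C * chi k z).
  apply: (@cintegrable_bounded_mul _ _ _ 1) => //; first exact: cmeasurable_chi.
  by move=> z; rewrite normsq_chi.
have Nc : (fun z => (normsq (g z))%:C - c%:C) = (fun=> 0) %[ae mu].
  apply: fourier_uniqueness; first exact: cintegrableD.
  move=> k.
  rewrite (_ : (fun z => _) =
    fun z => (normsq (g z))%:C * chi k z + (- c%:C) * chi k z); last first.
    by apply/funext => z; rewrite mulrDl.
  rewrite cintegralD//; last exact/cintegrableZ/L2_cintegrable/L2_chi.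
  rewrite cintegralZ; last exact/L2_cintegrable/L2_chi.
  have [k0|k0|->] := ltgtP k 0.
  - by rewrite ng0// cintegral_chi ?lt_eqF// mulr0 addr0.
  - rewrite cintegral_chi ?gt_eqF// mulr0 addr0 -[RHS]conjc0 -(ng0 (- k)) ?oppr_lt0//.
    rewrite -cintegral_conj//; apply: eq_cintegral => z.
    rewrite rmorphM/= chi_conj opprK; congr (_ * _).
    by apply: complex_ext => //=; rewrite oppr0.
  - rewrite (eq_cintegral (g := fun z => (normsq (g z))%:C)); last first.
      by move=> z; rewrite chi0 mulr1.
    rewrite (eq_cintegral (f := chi 0) (g := fun z => 1%:C)); last exact: chi0.
    rewrite !cintegral_real Rintegral_cst// mul1r.
    rewrite [X in fine X](_ : _ = (2 * pi)%:E); last exact: arclengthT.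
    rewrite -/(sqnorm g) /= (_ : sqnorm g = c * (2 * pi)); last by rewrite divfK.
    by rewrite [X in X + _]rmorphM mulNr subrr.
(* At one such point of [E] the constant [c] equals [|g z|^2 = 0]. *)
have [z Ez] : exists2 z, E z & g z = 0 /\ (normsq (g z))%:C - c%:C = 0.
  apply: not_ae_eq0 => //; apply: filterS2 gE Nc => z gE Nc Ez.
  by split; [exact: gE|exact: Nc].
move=> [-> /eqP]; rewrite subr_eq0 /normsq/= expr0n addr0 => /eqP/(@complexI R) c0.
have : sqnorm g = 0.
  move: c0; rewrite /c => /esym/eqP; rewrite mulf_eq0 invr_eq0 (negbTE pi2) orbF.
  by move/eqP.
move=> /(sqnorm_eq0 Lg) gae; rewrite -[RHS]cintegral0.
apply: ae_eq_cintegral.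
- exact/cintegrable_measurable/cintegrable_inner/L2_chi.
- exact: cmeasurable_cst.
- by apply: filterS gae => w /[apply] ->; rewrite mul0r.
Qed.

(** Stated for an arbitrary [M] so that [H^2] and its orthogonal complement share the cancellation
    lemma [boundary_unique_mul]. *)
Definition boundary_unique (M : set (circle R -> R[i])) := forall u E,
  M u -> measurable E -> mu E <> 0%E ->
  (\forall z \ae mu, E z -> u z = 0) -> u = (fun=> 0) %[ae mu].

Lemma hardy_boundary_unique : boundary_unique H2.
Proof.
move=> f E Hf mE muE fE; have Lf := hardy_L2 Hf.
apply: L2_chi_eq0 => // -[n|n]; last exact: hardy_inner_chi.
(* The function is generalized: coefficient [n + 1] of [f] is coefficient [n] of [f / z]. *)
elim: n => [|n IH] in f Hf fE Lf *; first exact: (hardy_vanishing_mean mE muE).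
have -> : Posz n.+1 = Posz n - (-1) by rewrite opprK -addn1.
rewrite -inner_chi_shift; apply: IH; last 2 first.
- by apply: filterS fE => z fE Ez; rewrite fE// mulr0.
- exact: L2_chi_mul.
apply/hardyP; split; first exact: L2_chi_mul.
move=> m m0; rewrite inner_chi_shift opprK.
have : m + 1 <= 0 by rewrite lezD1.
(* [f / z] stays in [H^2] because its coefficient at [-1] is the mean of [f], which is [0]. *)
rewrite le_eqVlt => /predU1P[->|]; first exact: (hardy_vanishing_mean mE muE).
exact: hardy_inner_chi.
Qed.

Lemma hardy_orth_boundary_unique : boundary_unique H2orth.
Proof.
move=> w E /hardy_orth_conj Hw mE muE wE.
have := hardy_boundary_unique Hw mE muE; move=> h.
have {}h : (fun z => (w z)^*%C) = (fun=> 0) %[ae mu].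
  by apply: h; apply: filterS wE => z wE Ez; rewrite wE// conjc0.
by apply: filterS h => z /[apply] /eqP; rewrite conjc_eq0 => /eqP.
Qed.

End hardy_theory.

(** * The operator S and its adjoint *)

Section singular_operator.
Context {R : realType}.
Notation mu := (@arclength R).
Notation H2 := (@hardy R).
Notation H2orth := (orth_compl (@hardy R)).
Implicit Types (f g h u w a b : circle R -> R[i]) (E : set (circle R)).

Lemma measurable_zero_set a : cmeasurable a -> measurable (zero_set a).
Proof.
move=> [mr mi].
have -> : zero_set a = (fun z => Re (a z)) @^-1` [set 0] `&`
    (fun z => Im (a z)) @^-1` [set 0].
  apply/seteqP; split=> z /=; first by rewrite /zero_set/= => ->.
  by move=> [zr zi]; exact: complex_ext.
by apply: measurableI; rewrite -[X in measurable X]setTI; [apply: mr|apply: mi].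
Qed.

Lemma measurable_support0 a : cmeasurable a -> measurable (~` zero_set a).
Proof. by move=> ma; exact/measurableC/measurable_zero_set. Qed.

Lemma mu_support_neq0 a : cmeasurable a -> ~ (a = (fun=> 0) %[ae mu]) ->
  mu (~` zero_set a) <> 0%E.
Proof.
move=> ma a0 m0; apply: a0; exists (~` zero_set a); split => //.
  exact: measurable_support0.
by move=> z /=; rewrite /zero_set/=; apply: contra_not => ->.
Qed.

Lemma mu0_ae a : cmeasurable a -> mu (zero_set a) = 0%E ->
  \forall z \ae mu, a z <> 0.
Proof.
move=> ma m0; exists (zero_set a); split => //; first exact: measurable_zero_set.
by move=> z /= /contrapT.
Qed.

Lemma boundary_unique_mul (M : set (circle R -> R[i])) a u :
  boundary_unique M -> M u -> cmeasurable a -> ~ (a = (fun=> 0) %[ae mu]) ->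
  (fun z => a z * u z) = (fun=> 0) %[ae mu] -> u = (fun=> 0) %[ae mu].
Proof.
move=> uM Mu ma a0 au.
apply: (uM _ (~` zero_set a)) => //; first exact: measurable_support0.
  exact: mu_support_neq0.
apply: filterS au => z /(_ I) /eqP; rewrite mulf_eq0 => /orP[/eqP az|/eqP//].
by move=> /(_ az).
Qed.

(** [u - P u] lies both in [H^2] and in its orthogonal complement. Equality is only almost
    everywhere because [orth_proj] picks a representative. *)
Lemma P_plus_hardy u : H2 u -> P_plus u = u %[ae mu].
Proof.
move=> Hu; have [Hp Hq] := hardy_projP (hardy_L2 Hu).
have := hardy_cap_orth (hardyB Hu Hp) Hq.
by apply: filterS => z /[apply] /eqP; rewrite subr_eq0 => /eqP.
Qed.

Lemma P_plus_hardy_orth w : H2orth w -> P_plus w = (fun=> 0) %[ae mu].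
Proof.
move=> Hw; have [Hp Hq] := hardy_projP (hardy_orth_L2 Hw).
apply: hardy_cap_orth => //.
have := hardy_orthB Hw Hq.
by rewrite /Q_minus; under eq_fun do rewrite opprB addrC subrK.
Qed.

Lemma S_op_injective a b :
  (forall u w, H2 u -> H2orth w ->
    (fun z => a z * u z + b z * w z) = (fun=> 0) %[ae mu] ->
    u = (fun=> 0) %[ae mu] /\ w = (fun=> 0) %[ae mu]) ->
  L2_injective (S_op a b).
Proof.
move=> inj f g Lf Lg Sfg.
have [Pf Qf] := hardy_projP Lf; have [Pg Qg] := hardy_projP Lg.
(* Differences of projections are used instead of projections of [f - g]: the chosen representatives
   are additive only almost everywhere. *)
have [] := inj _ _ (hardyB Pf Pg) (hardy_orthB Qf Qg).
  apply: filterS Sfg => z /[apply]; rewrite /S_op => /eqP.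
  by rewrite -subr_eq0 => /eqP => <-; ring.
apply: filterS2 => z h1 h2 _; move: (h1 I) (h2 I) => {}h1 {}h2.
have : (P_plus f z - P_plus g z) + (Q_minus f z - Q_minus g z) = 0.
  by rewrite h1 h2 addr0.
by rewrite /Q_minus => h3; apply/eqP; rewrite -subr_eq0 -h3; apply/eqP; ring.
Qed.

(** * The adjoint, and the kernels of both operators *)

Section adjoint.
Variables a b : circle R -> R[i].
Hypotheses (La : Linfty_circle R a) (Lb : Linfty_circle R b).

Lemma Linfty_conj c : Linfty_circle R c -> Linfty_circle R (fun z => (c z)^*%C).
Proof.
move=> [mc cC]; split; first exact: cmeasurable_conj.
rewrite (@eq_Lnorm _ _ _ _ _ _ (fun z => (ComplexField.Normc.normc (c z))%:E))//.
by move=> z; congr EFin; case: (c z) => x y /=; rewrite sqrrN.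
Qed.

Lemma inner_mul_conj c f g : inner (fun z => c z * f z) g =
  inner f (fun z => (c z)^*%C * g z).
Proof. by apply: eq_cintegral => z; rewrite rmorphM/= conjcK; ring. Qed.

Lemma L2_S_op f : L2 f -> L2 (S_op a b f).
Proof.
move=> Lf; have [/hardy_L2 Lp /hardy_orth_L2 Lq] := hardy_projP Lf.
by apply: L2D; exact: L2_Linfty_mul.
Qed.

Lemma orth_inner0 u w : H2 u -> H2orth w -> inner u w = 0.
Proof.
move=> Hu [Lw w0]; rewrite (inner_sym Lw (hardy_L2 Hu)) w0 ?conjc0//.
Qed.

(** The explicit adjoint [P (conj(a) g) + Q (conj(b) g)]: each multiplier moves across as its
    conjugate, and the mixed terms vanish by orthogonality. It shows that the choice in [adjoint] is
    made from an inhabited set. *)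
Lemma inner_S_op f g : L2 f -> L2 g -> inner (S_op a b f) g =
  inner f (fun z => P_plus (fun z => (a z)^*%C * g z) z +
                    Q_minus (fun z => (b z)^*%C * g z) z).
Proof.
move=> Lf Lg; have [Pf Qf] := hardy_projP Lf.
have Lp := hardy_L2 Pf; have Lq := hardy_orth_L2 Qf.
have Lag : L2 (fun z => (a z)^*%C * g z) by exact/L2_Linfty_mul/Lg/Linfty_conj.
have Lbg : L2 (fun z => (b z)^*%C * g z) by exact/L2_Linfty_mul/Lg/Linfty_conj.
have [Pa Qa] := hardy_projP Lag; have [Pb Qb] := hardy_projP Lbg.
have Lpa := hardy_L2 Pa; have Lqa := hardy_orth_L2 Qa.
have Lpb := hardy_L2 Pb; have Lqb := hardy_orth_L2 Qb.
set ag := (fun z => (a z)^*%C * g z) in Lag Pa Qa Lpa Lqa *.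
set bg := (fun z => (b z)^*%C * g z) in Lbg Pb Qb Lpb Lqb *.
rewrite /S_op innerDl//; [|exact: L2_Linfty_mul|exact: L2_Linfty_mul].
rewrite !inner_mul_conj -/ag -/bg.
have decomp h : (fun z => P_plus h z + Q_minus h z) = h.
  by apply/funext => z; rewrite /Q_minus addrC subrK.
have -> : inner (P_plus f) ag = inner (P_plus f) (P_plus ag).
  rewrite -[in LHS](decomp ag) (innerDr Lpa Lqa Lp).
  by rewrite [X in _ + X]orth_inner0// addr0.
have -> : inner (Q_minus f) bg = inner (Q_minus f) (Q_minus bg).
  by rewrite -[in LHS](decomp bg) (innerDr Lpb Lqb Lq) Qf.2// add0r.
rewrite -[in RHS](decomp f) innerDl//; last exact: L2D.
rewrite (innerDr Lpa Lqb Lp) (innerDr Lpa Lqb Lq).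
by rewrite [X in _ + X + _]orth_inner0// [X in _ + (X + _)]Qf.2// addr0 add0r.
Qed.

Lemma adjointP g : L2 g -> L2 (adjoint (S_op a b) g) /\
  forall f, L2 f -> inner (S_op a b f) g = inner f (adjoint (S_op a b) g).
Proof.
move=> Lg; rewrite /adjoint; case: xgetP => [h -> //|].
have Lag : L2 (fun z => (a z)^*%C * g z) by exact/L2_Linfty_mul/Lg/Linfty_conj.
have Lbg : L2 (fun z => (b z)^*%C * g z) by exact/L2_Linfty_mul/Lg/Linfty_conj.
move=> /(_ (fun z => P_plus (fun z => (a z)^*%C * g z) z +
                    Q_minus (fun z => (b z)^*%C * g z) z))[]; split.
  apply: L2D; first exact: hardy_L2 (hardy_projP Lag).1.
  exact: hardy_orth_L2 (hardy_projP Lbg).2.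
by move=> f Lf; exact: inner_S_op.
Qed.

(** If two functions have the same image, their difference [g] is orthogonal to the range of
    [S_op a b]. Testing on [H^2] gives the condition on [conj(a) g], and testing on negative
    characters the one on [conj(b) g]. *)
Lemma adjoint_injective :
  (forall g, L2 g -> H2orth (fun z => (a z)^*%C * g z) ->
    H2 (fun z => (b z)^*%C * g z) -> g = (fun=> 0) %[ae mu]) ->
  L2_injective (adjoint (S_op a b)).
Proof.
move=> inj g1 g2 Lg1 Lg2 Sg.
have [L1 S1] := adjointP Lg1; have [L2' S2] := adjointP Lg2.
pose g z := g1 z - g2 z.
have Lg : L2 g by exact: L2B.
have S0 f : L2 f -> inner (S_op a b f) g = 0.
  move=> Lf; have Sf := L2_S_op Lf.
  rewrite innerBr// S1// S2// -innerBr//.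
  rewrite (inner_sym (L2B L1 L2') Lf) (ae_eq_inner (g := fun=> 0))//.
  - by rewrite inner0l conjc0.
  - exact: L2B.
  - exact: L2_cst.
  - by apply: filterS Sg => z /[apply] ->; rewrite subrr.
have Lag : L2 (fun z => (a z)^*%C * g z) by exact/L2_Linfty_mul/Lg/Linfty_conj.
have Lbg : L2 (fun z => (b z)^*%C * g z) by exact/L2_Linfty_mul/Lg/Linfty_conj.
have g0 : g = (fun=> 0) %[ae mu].
  apply: inj => //.
    split => // u Hu; have Lu := hardy_L2 Hu.
    rewrite (inner_sym Lu Lag) -inner_mul_conj.
    rewrite (ae_eq_inner (g := S_op a b u)) ?S0 ?conjc0//.
    + exact: L2_Linfty_mul.
    + exact: L2_S_op.
    + apply: filterS (P_plus_hardy Hu) => z /[apply] Pu.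
      by rewrite /S_op /Q_minus Pu subrr mulr0 addr0.
  apply/hardyP; split => // n n0; have Hw := hardy_orth_chi (R := R) n0.
  have Lw := hardy_orth_L2 Hw.
  rewrite (inner_sym Lw Lbg) -inner_mul_conj.
  rewrite (ae_eq_inner (g := S_op a b (chi n))) ?S0 ?conjc0//.
  + exact: L2_Linfty_mul.
  + exact: L2_S_op.
  + apply: filterS (P_plus_hardy_orth Hw) => z /[apply] Pw.
    by rewrite /S_op /Q_minus Pw mulr0 add0r subr0.
by apply: filterS g0 => z /[apply] /eqP; rewrite subr_eq0 => /eqP.
Qed.

(** The product of two [L^2] functions is only integrable, hence uniqueness of Fourier coefficients
    in [L^1]. *)
Lemma kernel_product_eq0 u w g : H2 u -> H2orth w -> L2 g ->
  (fun z => a z * u z + b z * w z) = (fun=> 0) %[ae mu] ->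
  H2orth (fun z => (a z)^*%C * g z) -> H2 (fun z => (b z)^*%C * g z) ->
  (fun z => a z * u z * (g z)^*%C) = (fun=> 0) %[ae mu] /\
  (fun z => b z * w z * (g z)^*%C) = (fun=> 0) %[ae mu].
Proof.
move=> Hu Hw Lg uw Hag Hbg.
have Lu := hardy_L2 Hu; have Lw := hardy_orth_L2 Hw.
have Lag := hardy_orth_L2 Hag; have Lbg := hardy_L2 Hbg.
have Lau : L2 (fun z => a z * u z) by exact: L2_Linfty_mul.
have Lbw : L2 (fun z => b z * w z) by exact: L2_Linfty_mul.
have au0 : (fun z => a z * u z * (g z)^*%C) = (fun=> 0) %[ae mu].
  apply: fourier_uniqueness; first exact: cintegrable_inner.
  (* For [k >= 0], [z^k u] stays in [H^2], orthogonal to [conj(a) g]. For [k < 0], [a u] is replaced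
     by [- b w], and [z^k w] stays orthogonal to [H^2], which contains [conj(b) g]. *)
  move=> k; have [k0|k0] := ltP k 0; last first.
    rewrite -[RHS](orth_inner0 (hardy_chi_mul k0 Hu) Hag).
    by apply: eq_cintegral => z; rewrite rmorphM/= conjcK; ring.
  have [_ w0] := hardy_orth_chi_mul (ltW k0) Hw.
  have := w0 _ Hbg.
  rewrite -(@inner_mul_conj b) => bw0.
  have : inner (fun z => chi k z * (a z * u z)) g =
         - inner (fun z => b z * (chi k z * w z)) g.
    have Lbcw : L2 (fun z => b z * (chi k z * w z)).
      by apply: L2_Linfty_mul => //; exact: L2_chi_mul.
    rewrite -mulN1r -innerZl//; apply: ae_eq_inner => //.
    - exact: L2_chi_mul.
    - exact: L2Z.
    - apply: filterS uw => z /[apply] /eqP; rewrite addr_eq0 => /eqP ->.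
      by ring.
  rewrite bw0 oppr0 => <-.
  by apply: eq_cintegral => z; ring.
split => //; apply: filterS2 au0 uw => z au0 uw _.
have := au0 I; have := uw I => /eqP; rewrite addr_eq0 => /eqP -> /eqP.
by rewrite mulNr oppr_eq0 => /eqP.
Qed.

Hypotheses (a_neq0 : ~ (a = (fun=> 0) %[ae mu]))
  (b_neq0 : ~ (b = (fun=> 0) %[ae mu])).

(** If one component is [0], the other is killed by a nonzero multiplier, and boundary uniqueness
    applies. *)
Lemma kernel_eq0 u w : H2 u -> H2orth w ->
  (fun z => a z * u z + b z * w z) = (fun=> 0) %[ae mu] ->
  u = (fun=> 0) %[ae mu] \/ w = (fun=> 0) %[ae mu] ->
  u = (fun=> 0) %[ae mu] /\ w = (fun=> 0) %[ae mu].
Proof.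
move=> Hu Hw uw [u0|w0]; split=> //.
  apply: (boundary_unique_mul hardy_orth_boundary_unique Hw Lb.1 b_neq0).
  apply: filterS2 uw u0 => z uw u0 _.
  by have := uw I; rewrite (u0 I) mulr0 add0r.
apply: (boundary_unique_mul hardy_boundary_unique Hu La.1 a_neq0).
apply: filterS2 uw w0 => z uw w0 _.
by have := uw I; rewrite (w0 I) mulr0 addr0.
Qed.

Lemma S_op_dichotomy : mu (zero_set a) = 0%E \/ mu (zero_set b) = 0%E ->
  L2_injective (S_op a b) \/ L2_injective (adjoint (S_op a b)).
Proof.
move=> Zab.
have [inj|ninj] := pselect (forall u w, H2 u -> H2orth w ->
    (fun z => a z * u z + b z * w z) = (fun=> 0) %[ae mu] ->
    u = (fun=> 0) %[ae mu] /\ w = (fun=> 0) %[ae mu]).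
  by left; exact: S_op_injective.
right; apply: adjoint_injective => g Lg Hag Hbg.
(* A nonzero [g] in the kernel of the adjoint forces every pair [(u, w)] in the kernel of [S_op a b]
   to be zero. *)
apply: contrapT => g0; apply: ninj => u w Hu Hw uw.
have [au0 bw0] := kernel_product_eq0 Hu Hw Lg uw Hag Hbg.
have mg := cmeasurable_conj (L2_measurable Lg).
have cg0 : ~ ((fun z => (g z)^*%C) = (fun=> 0) %[ae mu]).
  apply: contra_not g0; apply: filterS => z /[apply] /eqP.
  by rewrite conjc_eq0 => /eqP.
(* A multiplier that is nonzero almost everywhere is cancelled, leaving [conj(g)] as a nonzero
   multiplier of [u] or [w]. *)
have cancel c f : cmeasurable c -> mu (zero_set c) = 0%E ->
    (fun z => c z * f z * (g z)^*%C) = (fun=> 0) %[ae mu] ->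
    (fun z => (g z)^*%C * f z) = (fun=> 0) %[ae mu].
  move=> mc /(mu0_ae mc) c0; apply: filterS2 c0 => z /eqP c0 /[apply] /eqP.
  by rewrite -mulrA mulf_eq0 (negbTE c0)/= mulrC => /eqP.
apply: kernel_eq0 => //; case: Zab => [Za|Zb]; [left|right].
  apply: (boundary_unique_mul hardy_boundary_unique Hu mg cg0).
  exact: (cancel _ _ La.1 Za au0).
apply: (boundary_unique_mul hardy_orth_boundary_unique Hw mg cg0).
exact: (cancel _ _ Lb.1 Zb bw0).
Qed.

Lemma S_op_injective_zero_sets : (0 < mu (zero_set a `+` zero_set b))%E ->
  L2_injective (S_op a b).
Proof.
move=> Zab; have mZa := measurable_zero_set La.1.
have mZb := measurable_zero_set Lb.1.
apply: S_op_injective => u w Hu Hw uw; apply: kernel_eq0 => //.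
(* One of the two differences has positive measure. On [Z_a] minus [Z_b] the equation reads
   [b w = 0] with [b <> 0], so [w] vanishes there; symmetrically for [u]. *)
have [m1|m1] := pselect (mu (zero_set a `\` zero_set b) = 0%E); last first.
  right; pose E := zero_set a `\` zero_set b.
  apply: (hardy_orth_boundary_unique (E := E)) => //; first exact: measurableD.
  apply: filterS uw => z uw [za zb]; have := uw I.
  rewrite (_ : a z = 0)// mul0r add0r => /eqP; rewrite mulf_eq0.
  by move=> /orP[/eqP|/eqP//] => /zb.
left; pose E := zero_set b `\` zero_set a.
apply: (hardy_boundary_unique (E := E)) => //; first exact: measurableD.
  move=> m2; move: Zab; rewrite /setY.
  rewrite [X in (_ < X)%E](_ : _ = 0%E) ?ltxx//; apply: etrans m1.
  exact: (measureU0 (measurableD mZa mZb) (measurableD mZb mZa) m2).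
apply: filterS uw => z uw [zb za]; have := uw I.
rewrite (_ : b z = 0)// mul0r addr0 => /eqP; rewrite mulf_eq0.
by move=> /orP[/eqP|/eqP//] => /za.
Qed.

(** Every image under [S_op a b] vanishes on [E]. Writing [h] for the adjoint's value, [<h, h>] is
    the inner product of [S_op a b h] with the indicator of [E], hence [0]. *)
Lemma adjoint_restr_eq0 E : measurable E -> E `<=` zero_set a `&` zero_set b ->
  adjoint (S_op a b) (restr E (fun=> 1)) = (fun=> 0) %[ae mu].
Proof.
move=> mE Eab; have LE := L2_restr mE (L2_cst (R := R) 1).
have [Lh h0] := adjointP LE.
apply: sqnorm_eq0 => //; apply: (@complexI R).
rewrite -inner_sqnorm -h0// -[RHS]cintegral0; apply: eq_cintegral => z.
rewrite /restr indicE; have [/set_mem/Eab[za zb]|_] := boolP (z \in E).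
  by rewrite /S_op (_ : a z = 0)// (_ : b z = 0)// !mul0r addr0 mul0r.
by rewrite mul0r conjc0 mulr0.
Qed.

Lemma adjoint_injectiveP : mu (zero_set a) <> 0%E -> mu (zero_set b) <> 0%E ->
  L2_injective (adjoint (S_op a b)) <-> mu (zero_set a `&` zero_set b) = 0%E.
Proof.
move=> Za Zb; have mZa := measurable_zero_set La.1.
have mZb := measurable_zero_set Lb.1.
have mE : measurable (zero_set a `&` zero_set b) by exact: measurableI.
split=> [inj|Zab].
  have LE := L2_restr mE (L2_cst (R := R) 1).
  have L0 := L2_restr (@measurable0 _ (circle R)) (L2_cst (R := R) 1).
  (* The zero function is written as a restriction to [set0], so that the same lemma computes both
     images. *)
  have : restr (zero_set a `&` zero_set b) (fun=> 1) = restr set0 (fun=> 1) %[ae mu].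
    apply: inj => //; have S1 := adjoint_restr_eq0 mE (@subset_refl _ _).
    have S0 := adjoint_restr_eq0 (@measurable0 _ (circle R)) (@sub0set _ _).
    by apply: filterS2 S1 S0 => z e1 e0 _; rewrite (e1 I) (e0 I).
  move=> h; apply: (measure_negligible mE); apply: negligibleS h.
  move=> z Ez /(_ I); rewrite /restr !indicE (mem_set Ez) in_set0 mul1r mul0r.
  by move=> /eqP; rewrite oner_eq0.
apply: adjoint_injective => g Lg Hag Hbg.
(* [conj(a) g] vanishes on [Z_a], of positive measure; likewise [conj(b) g] on [Z_b]. Off the common
   zeros this leaves [g = 0]. *)
have ag0 : (fun z => (a z)^*%C * g z) = (fun=> 0) %[ae mu].
  apply: (hardy_orth_boundary_unique Hag mZa Za); apply: aeW => z.
  by rewrite /zero_set/= => ->; rewrite conjc0 mul0r.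
have bg0 : (fun z => (b z)^*%C * g z) = (fun=> 0) %[ae mu].
  apply: (hardy_boundary_unique Hbg mZb Zb); apply: aeW => z.
  by rewrite /zero_set/= => ->; rewrite conjc0 mul0r.
have Zae : \forall z \ae mu, ~ (zero_set a `&` zero_set b) z.
  by exists (zero_set a `&` zero_set b); split => // z /= /contrapT.
apply: filterS3 ag0 bg0 Zae => z ag bg zab _; apply: contrapT => /eqP gz; apply: zab.
move: (ag I) (bg I) => /eqP + /eqP.
by rewrite !mulf_eq0 (negbTE gz) !orbF !conjc_eq0 => /eqP ? /eqP ?; split.
Qed.

End adjoint.
End singular_operator.

Theorem theorem9p1 (R : realType) (alpha beta : circle R -> R[i])
    (Lalpha : Linfty_circle R alpha) (Lbeta : Linfty_circle R beta)
    (alpha_neq0 : ~ (alpha = (fun=> 0) %[ae @arclength R]))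
    (beta_neq0 : ~ (beta = (fun=> 0) %[ae @arclength R])) :
  [/\ (arclength (zero_set alpha) = 0%E \/ arclength (zero_set beta) = 0%E ->
        L2_injective (S_op alpha beta) \/
        L2_injective (adjoint (S_op alpha beta))),
      (arclength (zero_set alpha) <> 0%E -> arclength (zero_set beta) <> 0%E ->
        (0 < arclength (zero_set alpha `+` zero_set beta))%E ->
        L2_injective (S_op alpha beta))
    & (arclength (zero_set alpha) <> 0%E -> arclength (zero_set beta) <> 0%E ->
        (L2_injective (adjoint (S_op alpha beta)) <->
         arclength (zero_set alpha `&` zero_set beta) = 0%E))].
Proof.
split; first exact: S_op_dichotomy.
  by move=> _ _; exact: S_op_injective_zero_sets.
exact: adjoint_injectiveP.
Qed.
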